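(* Let $\Phi=(\phi_1,\dots,\phi_K)$ be a unit norm tight frame in $\mathbb{R}^d$ with frame constant $A=K/d$ and coherence $\mu$. Let signals be generated as $y=\Phi x+r$, where $r$ is a random noise vector independent of $x$ with $\|r\|_2\le\rho_{\max}$ almost surely, $\mathbb{E}(r)=0$ and $\mathbb{E}(rr^\star)=\rho^2 I$, and where $x$ is drawn from a symmetric probability distribution $\nu$ on $S^{K-1}$ with $\mathbb{E}_x\|x\|_\infty^2=\bar c_1^2$. Assume there exists $\beta<1/2$ such that $$\nu\Big(\frac{c_2(x)+\mu\|c(x)\|_1+\rho_{\max}}{c_1(x)-c_2(x)}\le\beta\Big)=1.$$ Then $\Phi$ is a local maximum of $\max_{\Psi\in\mathcal D}\mathbb{E}_y\|\Psi^\star y\|_\infty^2$, and for all $\Psi\in\mathcal D$ with $0<\max_i\|\psi_i-\phi_i\|_2\le\varepsilon$ we have $\mathbb{E}_y\|\Psi^\star y\|_\infty^2<\mathbb{E}_y\|\Phi^\star y\|_\infty^2$ as soon as $\varepsilon<1/5$ and $$\varepsilon\le\frac{(1-2\beta)^2}{2A\log\Big(2AK\big/\big(\bar c_1^2-\frac{1-\bar c_1^2}{K-1}\big)\Big)}.$$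
   Context: $\mathcal D$ is the set of dictionaries $\Psi=(\psi_1,\dots,\psi_K)$, $\psi_i\in\mathbb{R}^d$, $\|\psi_i\|_2=1$. Unit norm tight frame with frame constant $A$: $\sum_i|\langle\phi_i,v\rangle|^2=A\|v\|_2^2$ for all $v$; coherence $\mu=\max_{i\ne j}|\langle\phi_i,\phi_j\rangle|$. A probability measure $\nu$ on $S^{K-1}\subset\mathbb{R}^K$ is symmetric if it is invariant under flipping signs of any coordinates and under any permutation of coordinates. For $x\in S^{K-1}$, $c_1(x)\ge\dots\ge c_K(x)\ge0$ is the non-increasing rearrangement of $(|x_1|,\dots,|x_K|)$, $c(x)$ the resulting vector. *)

(* Defs.v *)
From HB Require Import structures.
From mathcomp Require Import all_boot all_order all_algebra.
From mathcomp Require Import all_classical all_reals all_analysis.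
From mathcomp Require Import fingroup perm.
Set Implicit Arguments. Unset Strict Implicit. Unset Printing Implicit Defensive.
Import Order.TTheory GRing.Theory Num.Theory.
Import numFieldNormedType.Exports.
Local Open Scope classical_set_scope.
Local Open Scope ring_scope.

Section Defs.
Variable R : realType.

(* A dictionary of K atoms in R^d is a d x K matrix whose columns are the atoms. *)
Definition atom_ip d K (Psi : 'M[R]_(d, K)) (i : 'I_K) (v : 'I_d -> R) : R :=
  \sum_(k < d) Psi k i * v k.

Definition l2norm d (v : 'I_d -> R) : R := Num.sqrt (\sum_(k < d) v k ^+ 2).

Definition is_dict d K (Psi : 'M[R]_(d, K)) : Prop :=
  forall i : 'I_K, l2norm (fun k => Psi k i) = 1.

Definition unit_norm_tight_frame d K (Phi : 'M[R]_(d, K)) (A : R) : Prop :=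
  is_dict Phi /\
  forall v : 'I_d -> R,
    \sum_(i < K) (atom_ip Phi i v) ^+ 2 = A * (l2norm v) ^+ 2.

Definition coherence d K (Phi : 'M[R]_(d, K)) : R :=
  \big[Num.max/0]_(i < K) \big[Num.max/0]_(j < K | j != i)
     `| atom_ip Phi i (fun k => Phi k j) |.

Definition dict_dist d K (Psi Phi : 'M[R]_(d, K)) : R :=
  \big[Num.max/0]_(i < K) l2norm (fun k => Psi k i - Phi k i).

Definition sup_sq d K (Psi : 'M[R]_(d, K)) (y : 'I_d -> R) : R :=
  \big[Num.max/0]_(i < K) (atom_ip Psi i y) ^+ 2.

Definition rearr K (x : 'I_K -> R) : seq R :=
  sort (fun a b : R => b <= a) [seq `|x i| | i <- enum 'I_K].
Definition c_ K (x : 'I_K -> R) (n : nat) : R := nth 0 (rearr x) n.-1.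
Definition c_l1 K (x : 'I_K -> R) : R := \sum_(i < K) `|x i|.

Section Prob.
Context {dT : measure_display} {T : measurableType dT}.
Variable P : probability T R.

Definition signal d K (Phi : 'M[R]_(d, K)) (X : 'I_K -> T -> R)
  (Rn : 'I_d -> T -> R) (w : T) : 'I_d -> R :=
  fun k => \sum_(i < K) Phi k i * X i w + Rn k w.

Definition objective d K (Psi Phi : 'M[R]_(d, K)) (X : 'I_K -> T -> R)
  (Rn : 'I_d -> T -> R) : \bar R :=
  (\int[P]_w (sup_sq Psi (signal Phi X Rn w))%:E)%E.

Definition box_event (n : nat) (F : 'I_n -> T -> R) (B : 'I_n -> set R) : set T :=
  [set w | forall i, B i (F i w)].

(* independence of the random vectors X and Rn (joint law = product law,
   tested on the generating pi-system of measurable boxes) *)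
Definition indep_vec d K (X : 'I_K -> T -> R) (Rn : 'I_d -> T -> R) : Prop :=
  forall (A : 'I_K -> set R) (B : 'I_d -> set R),
    (forall i, measurable (A i)) -> (forall k, measurable (B k)) ->
    P (box_event X A `&` box_event Rn B) = (P (box_event X A) * P (box_event Rn B))%E.

(* the law of X is symmetric: invariant under sign flips of any coordinates and
   under permutations of coordinates (laws compared on measurable boxes) *)
Definition symmetric_law K (X : 'I_K -> T -> R) : Prop :=
  forall (s : 'I_K -> bool) (sigma : {perm 'I_K}) (A : 'I_K -> set R),
    (forall i, measurable (A i)) ->
    P (box_event X A) =
    P (box_event (fun i w => (-1) ^+ s i * X (sigma i) w) A).

End Prob.
End Defs.

(* Main.v *)
(** Write [y = Phi x + r] and [e_j = |psi_j - phi_j|], and let [i] be the position of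
    the largest coefficient of [x]. The separation condition makes [phi_i] beat
    every other atom of [Phi] on [y] by a margin proportional to [|x_i|], and a
    nearby dictionary inherits this unless a Rademacher sum
    [sum_(l != i) +- x_l <psi_j - phi_j, phi_l>] is large. So [sup_j <psi_j, y>^2] is
    at most [<psi_i, y>^2] plus the excesses [max(0, <psi_j, y>^2 - <psi_i, y>^2)],
    and averaging over the signs of [x], a Chernoff bound makes each excess
    exponentially small in [1 / (e_i^2 + e_j^2)]. The term [i] is left out of the
    Rademacher sum because the other coefficients are at most half as large, which
    is what leaves room for [eps < 1/5].
    The law of [x] is not changed by averaging over all sign changes and
    permutations. This average turns [<psi_i, y>^2] into an affine function of
    [x_i^2] and [<psi_j, r>^2], whose expectation is
    [const + gamma * mean_j <psi_j, phi_j>^2] with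
    [gamma = c1bar^2 - (1 - c1bar^2) / (K - 1)]. Since
    [<psi_j, phi_j> = 1 - e_j^2 / 2], the loss of order [gamma e_j^2] dominates all
    excesses. *)
Require Import Defs.
From HB Require Import structures.
From mathcomp Require Import all_boot all_order all_algebra.
From mathcomp Require Import all_classical all_reals all_analysis.
From mathcomp Require Import fingroup perm.
From mathcomp Require Import ring lra measurable_realfun.
Set Implicit Arguments. Unset Strict Implicit. Unset Printing Implicit Defensive.
Import Order.TTheory GRing.Theory Num.Theory.
Import numFieldNormedType.Exports.
Local Open Scope classical_set_scope.
Local Open Scope ring_scope.

(** * Means over finite types *)

Section Mean.
Variable R : numFieldType.
Implicit Types T U : finType.

Definition mean T (f : T -> R) : R := (\sum_t f t) / #|T|%:R.

Lemma eq_mean T (f g : T -> R) : f =1 g -> mean f = mean g.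
Proof. by move=> fg; congr (_ / _); apply: eq_bigr => t _; exact: fg. Qed.

Lemma mean_cst T (a : R) : (0 < #|T|)%N -> mean (fun _ : T => a) = a.
Proof.
by move=> T0; rewrite /mean sumr_const -[a *+ _]mulr_natr mulfK// pnatr_eq0 -lt0n.
Qed.

Lemma meanD T (f g : T -> R) : mean (fun t => f t + g t) = mean f + mean g.
Proof. by rewrite /mean big_split mulrDl. Qed.

Lemma mean_sum T (J : Type) (r : seq J) (Q : pred J) (f : J -> T -> R) :
  mean (fun t => \sum_(j <- r | Q j) f j t) = \sum_(j <- r | Q j) mean (f j).
Proof. by rewrite /mean exchange_big mulr_suml. Qed.

Lemma meanMl T (a : R) (f : T -> R) : mean (fun t => a * f t) = a * mean f.
Proof. by rewrite /mean -mulr_sumr mulrA. Qed.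

Lemma meanMr T (a : R) (f : T -> R) : mean (fun t => f t * a) = mean f * a.
Proof. by rewrite /mean -mulr_suml mulrAC. Qed.

Lemma meanN T (f : T -> R) : mean (fun t => - f t) = - mean f.
Proof. by rewrite /mean sumrN mulNr. Qed.

Lemma meanB T (f g : T -> R) : mean (fun t => f t - g t) = mean f - mean g.
Proof. by rewrite meanD meanN. Qed.

Lemma mean_ge0 T (f : T -> R) : (forall t, 0 <= f t) -> 0 <= mean f.
Proof. by move=> f0; rewrite divr_ge0 ?sumr_ge0. Qed.

Lemma ler_mean T (f g : T -> R) : (forall t, f t <= g t) -> mean f <= mean g.
Proof. by move=> fg; rewrite ler_wpM2r ?invr_ge0 ?ler_sum. Qed.

Lemma exchange_mean T U (f : T -> U -> R) :
  mean (fun t => mean (f t)) = mean (fun u => mean (f^~ u)).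
Proof. by rewrite /mean -!mulr_suml exchange_big mulrAC. Qed.

Lemma reindex_mean T (h : T -> T) (f : T -> R) :
  injective h -> mean (fun t => f (h t)) = mean f.
Proof. by move=> h_inj; rewrite /mean -(reindex_inj (F := f) (P := predT) h_inj). Qed.

Lemma mean_odd T (h : T -> T) (f : T -> R) :
  injective h -> (forall t, f (h t) = - f t) -> mean f = 0.
Proof.
move=> h_inj fh; have /eqP := reindex_mean f h_inj.
by rewrite (eq_mean fh) meanN eqNr => /eqP.
Qed.

Section Permutations.
Variable I : finType.

Lemma natr_cardC1 (i : I) : #|[pred m | m != i]|%:R = #|I|%:R - 1 :> R.
Proof. by rewrite cardC1 -subn1 natrB//; apply/card_gt0P; exists i. Qed.

Lemma mean_permV (f : {perm I} -> R) : mean (fun s => f s^-1%g) = mean f.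
Proof. exact/reindex_mean/invg_inj. Qed.

Lemma mean_perm1 (f : I -> R) i : mean (fun s : {perm I} => f (s i)) = mean f.
Proof.
have I0 : (0 < #|I|)%N by apply/card_gt0P; exists i.
have P0 : (0 < #|{perm I}|)%N by apply/card_gt0P; exists 1%g.
transitivity (mean (fun s : {perm I} => mean (fun j => f (s j)))); last first.
  by rewrite (eq_mean (fun s => reindex_mean f (@perm_inj _ s))) mean_cst.
rewrite exchange_mean -[LHS](mean_cst _ I0); apply: eq_mean => j.
rewrite -(reindex_mean _ (mulgI (tperm i j))).
by apply: eq_mean => s /=; rewrite permM tpermL.
Qed.

Lemma mean_permV1 (f : I -> R) i : mean (fun s : {perm I} => f (s^-1%g i)) = mean f.
Proof. by rewrite (mean_permV (fun s => f (s i))) mean_perm1. Qed.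

Lemma mean_perm2 (f : I -> I -> R) i l : l != i ->
  mean (fun s : {perm I} => f (s i) (s l)) =
  mean (fun j => \sum_(m | m != j) f j m) / (#|I|%:R - 1).
Proof.
move=> li; have I1 : #|I|%:R - 1 != 0 :> R.
  by rewrite -(natr_cardC1 i) pnatr_eq0 -lt0n; apply/card_gt0P; exists l.
apply: (canRL (mulfK I1)); rewrite -(mean_perm1 _ i) -(natr_cardC1 i) mulr_natr.
rewrite -sumr_const -[RHS](_ : \sum_(m | m != i) mean (fun s : {perm I} =>
    f (s i) (s m)) = _).
  apply: eq_bigr => m mi; rewrite -[RHS](reindex_mean _ (mulgI (tperm l m))).
  by apply: eq_mean => s; rewrite !permM tpermR tpermD.
rewrite -mean_sum; apply: eq_mean => s.
rewrite [RHS](reindex_inj (@perm_inj _ s))/=; apply: eq_bigl => m.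
by rewrite (inj_eq perm_inj).
Qed.

(* Only the diagonal and the off-diagonal sum of [f] survive, since permutations
   act transitively on pairs of distinct indices. *)
Lemma mean_perm_sum (x : I -> R) (f : I -> I -> R) i :
  mean (fun s : {perm I} => \sum_l x (s l) * f (s^-1%g i) l) =
  x i * mean (fun j => f j j)
  + (\sum_(l | l != i) x l) *
    (mean (fun j => \sum_(m | m != j) f j m) / (#|I|%:R - 1)).
Proof.
rewrite -mean_permV.
under eq_mean => s.
  rewrite invgK (reindex_inj (@perm_inj _ s))/=.
  under eq_bigr do rewrite permK.
  over.
rewrite mean_sum (bigD1 i)//= meanMl (mean_perm1 (fun j => f j j)).
rewrite mulr_suml; congr (_ + _); apply: eq_bigr => l li.
by rewrite meanMl mean_perm2.
Qed.

End Permutations.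

Lemma mean_pair_sum_le (I : finType) (f : I -> R) : (forall i, 0 <= f i) ->
  mean (fun i => \sum_(j | j != i) (f i + f j)) <= 2 * #|I|%:R * mean f.
Proof.
move=> f0; have [I0|I0] := posnP #|I|; first by rewrite /mean I0 invr0 !mulr0.
have card_mean : #|I|%:R * mean f = \sum_j f j by rewrite mulrC divfK// pnatr_eq0 -lt0n.
apply: (@le_trans _ _ (mean (fun i => \sum_j (f i + f j)))).
  by apply: ler_mean => i; rewrite [leRHS](bigD1 i)//= lerDr addr_ge0.
under eq_mean do rewrite big_split sumr_const -[_ *+ _]mulr_natl.
by rewrite meanD mean_cst// meanMl card_mean -mulrA card_mean mulr_natl mulr2n.
Qed.

End Mean.

(** * Rademacher sums *)

Section ExpBounds.
Variable R : realType.
Implicit Types x a b : R.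

Lemma is_derive_ge0_le (f f' : R -> R) a :
  (forall x : R, is_derive x (1 : R) f (f' x)) ->
  (forall x, 0 <= x -> 0 <= f' x) -> 0 <= a -> f 0 <= f a.
Proof.
move=> df f'0 a0.
have drv x : derivable f x 1 by have [] := df x.
apply: (@ger0_derive1_ndecry _ f 0) => // [x|].
  rewrite in_itv/= andbT => /ltW x0.
  by rewrite derive1E; have [_ ->] := df x; exact: f'0.
apply: continuous_subspaceT => x.
by apply: differentiable_continuous; apply/derivable1_diffP.
Qed.

Lemma sinh_le_mul_cosh a : 0 <= a ->
  expR a - expR (- a) <= a * (expR a + expR (- a)).
Proof.
move=> a0; rewrite -subr_ge0.
pose f x := x * (expR x + expR (- x)) - (expR x - expR (- x)).
have -> : 0 = f 0 by rewrite /f oppr0 mul0r subrr subr0.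
apply: (is_derive_ge0_le (f' := fun x => x * (expR x - expR (- x)))) a0 => x.
  by rewrite /f; apply: is_derive_eq; rewrite /GRing.scale/=; ring.
by move=> x0; rewrite mulr_ge0// subr_ge0 ler_expR; lra.
Qed.

Lemma cosh_le_expR_sqr a : expR a + expR (- a) <= 2 * expR (a ^+ 2 / 2).
Proof.
wlog a0 : a / 0 <= a.
  move=> wlog_ge0; case: (leP 0 a) => [/wlog_ge0 //|a_lt0].
  by rewrite addrC -{2}(opprK a) -(sqrrN a); apply: wlog_ge0; lra.
pose f x := - (expR (- (x ^+ 2 / 2)) * (expR x + expR (- x))).
have : f 0 <= f a.
  apply: (is_derive_ge0_le (f' := fun x => expR (- (x ^+ 2 / 2)) *
      (x * (expR x + expR (- x)) - (expR x - expR (- x))))) a0 => x.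
    by rewrite /f; apply: is_derive_eq; rewrite /GRing.scale/=; field.
  by move=> x0; rewrite mulr_ge0 ?expR_ge0// subr_ge0 sinh_le_mul_cosh.
rewrite /f lerN2 expr0n/= mul0r oppr0 expR0 mul1r => fa.
by rewrite -ler_pdivrMr ?expR_gt0// -expRN mulrC; apply: le_trans fa _; lra.
Qed.

Lemma expR_norm_le a : expR `|a| <= expR a + expR (- a).
Proof. by case: (ger0P a) => _; rewrite ?lerDl ?lerDr expR_ge0. Qed.

End ExpBounds.

Section Rademacher.
Variables (R : realType) (I : finType).
Implicit Types (a b : I -> R) (s : {ffun I -> bool}).

Definition rademacher a s : R := \sum_i (-1) ^+ s i * a i.

Lemma rademacherD a b s :
  rademacher (fun i => a i + b i) s = rademacher a s + rademacher b s.
Proof. by rewrite -big_split; apply: eq_bigr => i _; rewrite mulrDr. Qed.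

Lemma rademacherM (t : R) a s :
  rademacher (fun i => t * a i) s = t * rademacher a s.
Proof. by rewrite mulr_sumr; apply: eq_bigr => i _; rewrite mulrCA. Qed.

Lemma card_signs_gt0 : (0 < #|{ffun I -> bool}|)%N.
Proof. by apply/card_gt0P; exists [ffun=> true]. Qed.

Lemma mean_expR_rademacher a :
  mean (fun s => expR (rademacher a s)) <= expR (\sum_i a i ^+ 2 / 2).
Proof.
rewrite /mean ler_pdivrMr ?ltr0n ?card_signs_gt0//.
rewrite card_ffun card_bool natrX.
under eq_bigr do rewrite expR_sum.
rewrite -(bigA_distr_bigA (fun i (t : bool) => expR ((-1) ^+ t * a i))).
rewrite expR_sum -prodr_const -big_split/=.
apply: ler_prod => i _; rewrite big_bool/= expr0 expr1 mul1r mulN1r.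
by rewrite addr_ge0 ?expR_ge0//= addrC [leRHS]mulrC cosh_le_expR_sqr.
Qed.

Lemma mean_expR_abs_rademacher a b :
  mean (fun s => expR (`|rademacher a s| + `|rademacher b s|)) <=
  4 * expR (\sum_i a i ^+ 2 + \sum_i b i ^+ 2).
Proof.
set V := expR _.
have subgaussian t u : t ^+ 2 = 1 -> u ^+ 2 = 1 ->
    mean (fun s => expR (t * rademacher a s + u * rademacher b s)) <= V.
  move=> t1 u1.
  under eq_mean do rewrite -!rademacherM -rademacherD.
  apply: le_trans (mean_expR_rademacher _) _.
  rewrite ler_expR -big_split; apply: ler_sum => i _ /=.
  have := sqr_ge0 (t * a i - u * b i).
  by rewrite sqrrB sqrrD !exprMn t1 u1; lra.
have one2 : (1 : R) ^+ 2 = 1 by rewrite expr1n.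
have mone2 : (-1 : R) ^+ 2 = 1 by rewrite sqrrN expr1n.
have := subgaussian _ _ one2 one2; have := subgaussian _ _ one2 mone2.
have := subgaussian _ _ mone2 one2; have := subgaussian _ _ mone2 mone2.
move=> nn np pn pp; suff : mean (fun s => expR (`|rademacher a s| + `|rademacher b s|))
    <= mean (fun s => expR (1 * rademacher a s + 1 * rademacher b s)) +
       mean (fun s => expR (1 * rademacher a s + -1 * rademacher b s)) +
       mean (fun s => expR (-1 * rademacher a s + 1 * rademacher b s)) +
       mean (fun s => expR (-1 * rademacher a s + -1 * rademacher b s)) by lra.
rewrite -!meanD; apply: ler_mean => s; rewrite !mul1r !mulN1r !expRD.
have := ler_pM (expR_ge0 _) (expR_ge0 _) (expR_norm_le (rademacher a s))
  (expR_norm_le (rademacher b s)).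
by rewrite mulrDl !mulrDr !addrA.
Qed.

Lemma mean_expR_abs_rademacherM (t : R) a b : 0 <= t ->
  mean (fun s => expR (t * (`|rademacher a s| + `|rademacher b s|))) <=
  4 * expR (t ^+ 2 * (\sum_i a i ^+ 2 + \sum_i b i ^+ 2)).
Proof.
move=> t0; under eq_mean do
  rewrite mulrDr -{1 2}(ger0_norm t0) -!normrM -!rademacherM.
apply: le_trans (mean_expR_abs_rademacher _ _) _.
by rewrite mulrDr !mulr_sumr; under eq_bigr do rewrite exprMn;
  under [X in _ + X]eq_bigr do rewrite exprMn.
Qed.

Definition flip (i : I) s : {ffun I -> bool} := [ffun j => (j == i) (+) s j].

Lemma flipK i : involutive (flip i).
Proof. by move=> s; apply/ffunP => j; rewrite !ffunE addKb. Qed.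

Lemma mean_sign i : mean (fun s : {ffun I -> bool} => (-1) ^+ s i) = 0 :> R.
Proof.
apply: (mean_odd (can_inj (flipK i))) => s.
by rewrite ffunE eqxx signr_addb mulN1r.
Qed.

Lemma mean_signM i j :
  mean (fun s : {ffun I -> bool} => (-1) ^+ s i * (-1) ^+ s j) = (i == j)%:R :> R.
Proof.
have [<-|ij] := eqVneq i j.
  under eq_mean do rewrite -signr_addb addbb.
  exact/mean_cst/card_signs_gt0.
apply: (mean_odd (can_inj (flipK i))) => s.
by rewrite !ffunE eqxx eq_sym (negbTE ij) signr_addb mulN1r mulNr.
Qed.

Lemma mean_rademacher a : mean (rademacher a) = 0.
Proof. by rewrite mean_sum big1// => i _; rewrite meanMr mean_sign mul0r. Qed.

Lemma mean_sqr_rademacher a (b : R) :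
  mean (fun s => (rademacher a s + b) ^+ 2) = \sum_i a i ^+ 2 + b ^+ 2.
Proof.
under eq_mean do rewrite sqrrD -[_ *+ 2]mulr_natr.
rewrite !meanD !meanMr mean_rademacher !mul0r addr0 mean_cst ?card_signs_gt0//.
congr (_ + _).
under eq_mean do rewrite expr2 mulr_suml.
rewrite mean_sum; apply: eq_bigr => i _.
under eq_mean do rewrite mulr_sumr.
rewrite mean_sum (bigD1 i)//= big1 ?addr0 => [|j ji];
  under eq_mean do rewrite mulrACA;
  rewrite meanMr mean_signM ?eqxx ?mul1r//.
by rewrite eq_sym (negbTE ji) mul0r.
Qed.

End Rademacher.

(** * Dictionaries and frames *)

Lemma ler_sqr_norm (R : realDomainType) (a b : R) : `|a| <= `|b| -> a ^+ 2 <= b ^+ 2.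
Proof. by rewrite -ler_sqr ?nnegrE// !real_normK ?num_real. Qed.

Section InnerProduct.
Variables (R : realType) (d : nat).
Implicit Types u v w : 'I_d -> R.

Definition ip u v : R := \sum_k u k * v k.

Lemma ipC u v : ip u v = ip v u.
Proof. by apply: eq_bigr => k _; rewrite mulrC. Qed.

Lemma ipBl u v w : ip (fun k => u k - v k) w = ip u w - ip v w.
Proof. by rewrite -sumrB; apply: eq_bigr => k _; rewrite mulrBl. Qed.

Lemma l2norm_ge0 v : 0 <= l2norm v.
Proof. exact: sqrtr_ge0. Qed.

Lemma l2norm_sqr v : l2norm v ^+ 2 = ip v v.
Proof. by rewrite sqr_sqrtr ?sumr_ge0// => k _; exact: sqr_ge0. Qed.

Lemma l2norm_eq0 v : (l2norm v == 0) = [forall k, v k == 0].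
Proof.
rewrite sqrtr_eq0 le_eqVlt ltNge sumr_ge0 ?orbF => [|k _]; last exact: sqr_ge0.
rewrite psumr_eq0 => [|k _]; last exact: sqr_ge0.
by rewrite -big_all big_andE; apply: eq_forallb => k; rewrite sqrf_eq0.
Qed.

Lemma ip_sqr_le u v : ip u v ^+ 2 <= ip u u * ip v v.
Proof.
have : 0 <= \sum_k \sum_l (u k * v l - u l * v k) ^+ 2.
  by apply: sumr_ge0 => k _; apply: sumr_ge0 => l _; exact: sqr_ge0.
have sumM (f g : 'I_d -> R) :
    \sum_k \sum_l f k * g l = (\sum_k f k) * (\sum_l g l).
  by rewrite mulr_suml; apply: eq_bigr => k _; rewrite mulr_sumr.
have -> : \sum_k \sum_l (u k * v l - u l * v k) ^+ 2 =
    \sum_k \sum_l (u k * u k) * (v l * v l)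
    + \sum_k \sum_l (v k * v k) * (u l * u l)
    - 2 * \sum_k \sum_l (u k * v k) * (u l * v l).
  rewrite mulr_sumr -big_split -sumrB; apply: eq_bigr => k _ /=.
  by rewrite mulr_sumr -big_split -sumrB; apply: eq_bigr => l _ /=; ring.
by rewrite !sumM -/(ip u u) -/(ip v v) -/(ip u v); lra.
Qed.

Lemma ip_le_l2norm u v : `|ip u v| <= l2norm u * l2norm v.
Proof.
rewrite -ler_sqr ?nnegrE ?mulr_ge0 ?l2norm_ge0//.
by rewrite real_normK ?num_real// exprMn !l2norm_sqr ip_sqr_le.
Qed.

End InnerProduct.

Section Frames.
Variables (R : realType) (d K : nat).
Implicit Types (Phi Psi : 'M[R]_(d, K)) (x : 'I_K -> R) (r u : 'I_d -> R).

Definition synth Phi x r : 'I_d -> R := fun k => \sum_i Phi k i * x i + r k.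

Lemma ip_synth Phi x r u :
  ip u (synth Phi x r) = \sum_l x l * ip (Phi^~ l) u + ip u r.
Proof.
rewrite /ip /synth; under eq_bigr do rewrite mulrDr mulr_sumr.
rewrite big_split exchange_big; congr (_ + _); apply: eq_bigr => l _.
by rewrite mulr_sumr; apply: eq_bigr => k _; ring.
Qed.

Definition atom_diff Psi Phi (i : 'I_K) : 'I_d -> R := fun k => Psi k i - Phi k i.

Lemma dict_ip1 Phi i : is_dict Phi -> ip (Phi^~ i) (Phi^~ i) = 1.
Proof. by move=> /(_ i) dictPhi; rewrite -l2norm_sqr dictPhi expr1n. Qed.

Lemma ip_atoms Psi Phi i : is_dict Psi -> is_dict Phi ->
  ip (Phi^~ i) (Psi^~ i) = 1 - l2norm (atom_diff Psi Phi i) ^+ 2 / 2.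
Proof.
move=> dictPsi dictPhi; rewrite l2norm_sqr !(ipBl, ipC _ (atom_diff _ _ _)).
by rewrite !dict_ip1// (ipC (Psi^~ i)); field.
Qed.

Lemma coherence_ge0 Phi : 0 <= coherence Phi.
Proof. exact: bigmax_ge_id. Qed.

Lemma ip_le_coherence Phi i j : j != i ->
  `|ip (Phi^~ i) (Phi^~ j)| <= coherence Phi.
Proof.
move=> ji; apply: le_trans (le_bigmax _ _ i).
exact: (@le_bigmax_cond _ _ _ _ j (fun j => j != i)
  (fun j => `|ip (Phi^~ i) (Phi^~ j)|)).
Qed.

Lemma c_l1_ge0 x : 0 <= c_l1 x.
Proof. by rewrite sumr_ge0. Qed.

Lemma coherenceM_c_l1_ge0 Phi x : 0 <= coherence Phi * c_l1 x.
Proof. by rewrite mulr_ge0 ?coherence_ge0 ?c_l1_ge0. Qed.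

Lemma analysis_coef_dist Phi x r i : is_dict Phi ->
  `|ip (Phi^~ i) (synth Phi x r) - x i| <= coherence Phi * c_l1 x + l2norm r.
Proof.
move=> dictPhi; rewrite ip_synth (bigD1 i)//= dict_ip1// mulr1.
rewrite [_ - x i]addrC !addrA addNr add0r.
apply: le_trans (ler_normD _ _) _; apply: lerD; last first.
  by apply: le_trans (ip_le_l2norm _ _) _; rewrite dictPhi mul1r.
apply: le_trans (ler_norm_sum _ _ _) _.
rewrite mulr_sumr [leRHS](bigD1 i)//= ler_wpDl ?mulr_ge0 ?coherence_ge0//.
apply: ler_sum => l li; rewrite normrM mulrC ler_wpM2r// ipC.
exact: ip_le_coherence.
Qed.

Lemma tight_frame_sum Phi A u : unit_norm_tight_frame Phi A ->
  \sum_i ip (Phi^~ i) u ^+ 2 = A * l2norm u ^+ 2.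
Proof. by move=> [_ <-]. Qed.

Lemma tight_frame_sum_off Phi Psi A j :
  unit_norm_tight_frame Phi A -> is_dict Psi ->
  \sum_(l | l != j) ip (Phi^~ l) (Psi^~ j) ^+ 2 = A - ip (Phi^~ j) (Psi^~ j) ^+ 2.
Proof.
move=> frame dictPsi; have := tight_frame_sum (Psi^~ j) frame.
by rewrite dictPsi expr1n mulr1 (bigD1 j)//= => <-; rewrite addrAC subrr add0r.
Qed.

Lemma frame_constant_ge1 Phi A (i : 'I_K) : unit_norm_tight_frame Phi A -> 1 <= A.
Proof.
move=> frame; have dictPhi := frame.1.
have := tight_frame_sum (Phi^~ i) frame; rewrite dictPhi expr1n mulr1 => <-.
by rewrite (bigD1 i)//= dict_ip1// expr1n lerDl sumr_ge0// => j _; exact: sqr_ge0.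
Qed.

Lemma le_dict_dist Psi Phi i : l2norm (atom_diff Psi Phi i) <= dict_dist Psi Phi.
Proof. exact: (@le_bigmax _ _ _ _ (fun i => l2norm (atom_diff Psi Phi i))). Qed.

Lemma dict_dist_gt0 Psi Phi : 0 < dict_dist Psi Phi ->
  exists i, 0 < l2norm (atom_diff Psi Phi i).
Proof.
move=> dist_gt0; apply: contrapT => /forallNP diff_le0.
move: dist_gt0; rewrite ltNge => /negP; apply.
by apply: bigmax_le => // i _; rewrite leNgt; apply/negP; exact: diff_le0.
Qed.

Lemma dict_dist_le0 Psi Phi : dict_dist Psi Phi <= 0 -> Psi = Phi.
Proof.
move=> dist_le0; apply/matrixP => k i; apply/eqP; rewrite -subr_eq0.
have : l2norm (atom_diff Psi Phi i) == 0.
  by rewrite eq_le l2norm_ge0 andbT (le_trans (le_dict_dist _ _ _)).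
by rewrite l2norm_eq0 => /forallP/(_ k).
Qed.

End Frames.

(** * Separated coefficients *)

Section Separated.
Variables (R : realType) (d K : nat) (Phi : 'M[R]_(d, K)) (rho beta : R).
Implicit Types (x : 'I_K -> R) (i : 'I_K).

Definition separated_at i (c2 : R) x : Prop :=
  [/\ 0 <= c2, c2 < `|x i|, forall l, l != i -> `|x l| <= c2 &
    c2 + coherence Phi * c_l1 x + rho <= beta * (`|x i| - c2)].

Lemma rearr_top2 x : (0 < K)%N ->
  exists i, [/\ `|x i| = c_ x 1, 0 <= c_ x 2 & forall j, j != i -> `|x j| <= c_ x 2].
Proof.
move=> K0; rewrite /c_ /rearr sort_map/=.
set geq_abs := relpre _ _.
have geq_abs_trans : transitive geq_abs by move=> a b e /= ba eb; exact: le_trans ba.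
have : sorted geq_abs (sort geq_abs (enum 'I_K)).
  by apply: sort_sorted => a b /=; exact: le_total.
have : forall j, j \in sort geq_abs (enum 'I_K) by move=> j; rewrite mem_sort mem_enum.
case: (sort _ _) => [|i t] mem_t; first by have := mem_t (Ordinal K0).
rewrite /= (path_sortedE geq_abs_trans) => /andP[_ sorted_t].
exists i; split => //=; first by case: (t) => /=.
move=> j ji; have := mem_t j; rewrite inE (negbTE ji)/= => {mem_t}.
case: t sorted_t => [//|k t] /=; rewrite (path_sortedE geq_abs_trans) inE.
by move=> /andP[/allP le_k _] /orP[/eqP->//|/le_k].
Qed.

Lemma exists_separated_at x : (0 < K)%N -> 0 < c_ x 1 - c_ x 2 ->
  (c_ x 2 + coherence Phi * c_l1 x + rho) / (c_ x 1 - c_ x 2) <= beta ->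
  exists i, separated_at i (c_ x 2) x.
Proof.
move=> K0 c12; rewrite ler_pdivrMr// => sep.
have [i [xi c20 le_c2]] := rearr_top2 x K0.
by exists i; rewrite /separated_at xi -subr_gt0.
Qed.

Definition signed (s : {ffun 'I_K -> bool}) x : 'I_K -> R :=
  fun l => (-1) ^+ s l * x l.

Lemma normr_signed s x l : `|signed s x l| = `|x l|.
Proof. by rewrite normrMsign. Qed.

Lemma separated_signed s i c2 x : separated_at i c2 x -> separated_at i c2 (signed s x).
Proof.
case=> c20 c2_lt le_c2 sep; split; rewrite ?normr_signed//.
  by move=> l li; rewrite normr_signed le_c2.
by rewrite /c_l1; under eq_bigr do rewrite normr_signed.
Qed.

Lemma separated_perm (p : {perm 'I_K}) i c2 x :
  separated_at i c2 x -> separated_at (p^-1%g i) c2 (fun l => x (p l)).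
Proof.
case=> c20 c2_lt le_c2 sep; split; rewrite ?permKV//.
  by move=> l; rewrite -(inj_eq (@perm_inj _ p)) permKV => /le_c2.
rewrite [c_l1 _](_ : _ = c_l1 x)//.
by rewrite /c_l1 [RHS](reindex_inj (@perm_inj _ p)).
Qed.

Lemma separated_max i c2 x : separated_at i c2 x -> forall j, `|x j| <= `|x i|.
Proof.
case=> _ c2_lt le_c2 _ j; have [->//|/le_c2 xj] := eqVneq j i.
exact: le_trans (ltW c2_lt).
Qed.

Section Bounds.
Hypothesis rho_ge0 : 0 <= rho.
Variables (i : 'I_K) (c2 : R) (x : 'I_K -> R).
Hypothesis sep : separated_at i c2 x.

Lemma separated_beta_ge0 : 0 <= beta.
Proof.
have [c20 c2_lt _ sep_le] := sep.
rewrite -(pmulr_lge0 _ (_ : 0 < `|x i| - c2)) ?subr_gt0//.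
by apply: le_trans sep_le; rewrite !addr_ge0// coherenceM_c_l1_ge0.
Qed.

Lemma separated_c2_rho_le : c2 + rho <= beta * `|x i|.
Proof.
have [c20 _ _ sep_le] := sep; have := mulr_ge0 separated_beta_ge0 c20.
by have := coherenceM_c_l1_ge0 Phi x; lra.
Qed.

Lemma separated_ratio : 0 <= c2 / `|x i| <= beta.
Proof.
have [c20 c2_lt _ _] := sep; rewrite divr_ge0//= ler_pdivrMr ?(le_lt_trans c20)//.
by apply: le_trans separated_c2_rho_le; rewrite lerDl.
Qed.

End Bounds.
End Separated.

(** * The excess over the dominant atom *)

Section ExcessArithmetic.
Variable R : realType.
Implicit Types beta eps q z : R.

(* With [c2 = q c] the two largest coefficients, separation puts the dominant atom
   ahead of the others by [c + c2 - 2 beta (c - c2)], of which a perturbation of size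
   [eps] takes at most [2 eps (c + rho) <= 2 eps (1 + beta) c] before fluctuations. *)
Definition margin beta eps q : R :=
  1 - 2 * beta + (1 + 2 * beta) * q - 2 * eps * (1 + beta).

Lemma margin_ge beta eps q : 0 <= beta -> beta < 1 / 2 -> 0 <= q -> q <= beta ->
  eps < 1 / 5 -> 2 * eps <= (1 - 2 * beta) ^+ 2 ->
  3 * (1 - 2 * beta) * q <= margin beta eps q.
Proof.
move=> beta_ge0 beta_lt q_ge0 q_le eps_lt eps_le.
suff : 2 * eps * (1 + beta) <= 1 - 2 * beta - (2 - 8 * beta) * q.
  by rewrite /margin; lra.
have [beta_ge|/ltW beta_le] := lerP (1 / 4) beta.
  apply: (@le_trans _ _ (1 - 2 * beta)); last first.
    by rewrite lerDl oppr_ge0 mulr_le0_ge0//; lra.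
  apply: (@le_trans _ _ ((1 - 2 * beta) ^+ 2 * (1 + beta))).
    by rewrite ler_wpM2r//; lra.
  rewrite expr2 -mulrA ler_piMr//; first lra.
  by have := sqr_ge0 beta; lra.
apply: (@le_trans _ _ (2 / 5 * (1 + beta))); first by rewrite ler_wpM2r//; lra.
have : (2 - 8 * beta) * q <= (2 - 8 * beta) * beta by rewrite ler_wpM2l//; lra.
have : 0 <= (1 - 4 * beta) * (3 / 5 - 2 * beta) by rewrite mulr_ge0//; lra.
lra.
Qed.

Lemma margin_gt0 beta eps q : 0 <= beta -> beta < 1 / 2 -> 0 <= q -> q <= beta ->
  eps < 1 / 5 -> 2 * eps <= (1 - 2 * beta) ^+ 2 -> 0 < margin beta eps q.
Proof.
move=> beta_ge0 beta_lt q_ge0 q_le eps_lt eps_le.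
have [q_gt0|] := ltP 0 q.
  by apply: lt_le_trans (margin_ge _ _ _ _ _ _); rewrite // !mulr_gt0//; lra.
move=> q_le0; have -> : q = 0 by apply/le_anti/andP.
rewrite /margin mulr0 addr0 subr_gt0.
have [beta_eq0|beta_neq0] := eqVneq beta 0; first by rewrite beta_eq0; lra.
have beta_gt0 : 0 < beta by rewrite lt_def beta_neq0.
apply: (@le_lt_trans _ _ ((1 - 2 * beta) ^+ 2 * (1 + beta))).
  by rewrite ler_wpM2r//; lra.
rewrite expr2 -mulrA gtr_pMr; last lra.
by have := sqr_ge0 beta; lra.
Qed.

Lemma margin_le1 beta eps q : 0 <= beta -> beta <= 1 / 2 -> q <= beta ->
  0 <= eps -> margin beta eps q <= 1.
Proof.
move=> beta_ge0 beta_le q_le eps_ge0.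
have : 0 <= eps * (1 + beta) by rewrite mulr_ge0//; lra.
have : (1 + 2 * beta) * q <= 2 * beta; last by rewrite /margin; lra.
apply: (@le_trans _ _ ((1 + 2 * beta) * beta)); first by rewrite ler_wpM2l//; lra.
by rewrite ler_wpM2r//; lra.
Qed.

(* This value of [lam * tau] would minimise the exponent if [q] were [tau / (3 eta)]. *)
Lemma chernoff_exponent_le (eta q tau V lam : R) :
  0 < eta -> 0 < tau -> 0 < V -> 0 <= q -> 3 * eta * q <= tau ->
  lam * tau = 9 * eta ^+ 2 / (2 * V) ->
  (lam * q) ^+ 2 * V - lam * tau <= - (9 * eta ^+ 2 / (4 * V)).
Proof.
move=> eta_gt0 tau_gt0 V_gt0 q_ge0 q_le lamE.
have lam_gt0 : 0 < lam.
  by rewrite -(pmulr_lgt0 _ tau_gt0) lamE divr_gt0 ?mulr_gt0 ?exprn_gt0.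
have lamq_le : lam * q <= 3 * eta / (2 * V).
  rewrite -(ler_pM2l (_ : 0 < 3 * eta)) ?mulr_gt0// mulrCA.
  apply: le_trans (ler_wpM2l (ltW lam_gt0) q_le) _.
  have -> : lam * tau = 3 * eta * (3 * eta / (2 * V)); last exact: lexx.
  by rewrite lamE; field; rewrite gt_eqF.
have -> : - (9 * eta ^+ 2 / (4 * V)) = (3 * eta / (2 * V)) ^+ 2 * V - lam * tau.
  by rewrite lamE; field; rewrite gt_eqF.
have [lam_ge0 eta_ge0 V_ge0] := And3 (ltW lam_gt0) (ltW eta_gt0) (ltW V_gt0).
by rewrite lerD2r ler_pM2r// ler_sqr ?nnegrE ?divr_ge0 ?mulr_ge0.
Qed.

Lemma chernoff_exponent_ge2 (eta A eps V : R) : 0 < A -> 0 <= eps -> eps < 1 / 5 ->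
  2 * A * eps <= eta ^+ 2 -> 0 < V -> V <= 2 * eps ^+ 2 ->
  2 <= 9 * eta ^+ 2 / (2 * (A * V)).
Proof.
move=> A_gt0 eps_ge0 eps_lt eps_le V_gt0 V_le.
rewrite ler_pdivlMr ?mulr_gt0//.
have : A * V <= A * (2 * eps ^+ 2) by rewrite ler_pM2l.
have : 2 * A * eps * eps <= eta ^+ 2 * (1 / 5).
  by rewrite ler_pM ?mulr_ge0 ?(ltW A_gt0) ?(ltW eps_lt).
by have := sqr_ge0 eta; rewrite (expr2 eps); lra.
Qed.

Lemma cube_le_expR z : 0 <= z -> z ^+ 3 / 6 <= expR z.
Proof.
by move=> z0; apply: le_trans (expR_ge1Dxn 2 z0); rewrite !factS fact0 lerDr.
Qed.

(* With [z = eps / V] the hypotheses give [5 / 2 <= z] and [1 / (2 z^2) <= V], while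
   the exponent is at most [- 9/2 L z <= - L - (9/2 z - 1)]. *)
Lemma chernoff_bound_le (eta A L eps V : R) :
  1 <= L -> 0 < A -> 2 * A * L * eps <= eta ^+ 2 ->
  eps < 1 / 5 -> 0 < eps -> 0 < V -> V <= 2 * eps ^+ 2 ->
  4 * (expR 2 * expR (- (9 * eta ^+ 2 / (4 * (A * V)))))
  <= 4 / 5 * expR (- L) * V.
Proof.
move=> L1 A0 eps_le eps5 eps0 V0 V_le.
pose z := eps / V.
have z_ge : 1 <= 2 * eps * z.
  by rewrite /z mulrA ler_pdivlMr// mul1r -mulrA -expr2.
have z0 : 0 < z by rewrite divr_gt0.
have z52 : 5 / 2 <= z by nra.
have exponent_ge : 9 / 2 * L * z <= 9 * eta ^+ 2 / (4 * (A * V)).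
  have -> : 9 / 2 * L * z = 9 * (2 * A * L * eps) / (4 * (A * V)).
    by rewrite /z; field; rewrite !gt_eqF.
  by rewrite ler_pM2r ?invr_gt0 ?mulr_gt0// ler_pM2l.
have exponent_split : L + (9 / 2 * z - 1) <= 9 / 2 * L * z.
  have : 0 <= (L - 1) * (9 / 2 * z - 1) by rewrite mulr_ge0//; lra.
  lra.
apply: (@le_trans _ _ (expR (- L) * (4 * expR (3 - 9 / 2 * z)))).
  rewrite [leRHS]mulrCA ler_pM2l// -!expRD ler_expR; lra.
rewrite [leRHS]mulrAC [leRHS]mulrC ler_pM2l ?expR_gt0//.
have z2_gt0 : 0 < 2 * z ^+ 2 by rewrite pmulr_rgt0 ?exprn_gt0.
have V_ge : 1 / (2 * z ^+ 2) <= V.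
  rewrite ler_pdivrMr//.
  by have -> : V * (2 * z ^+ 2) = 2 * eps * z by rewrite /z; field; rewrite gt_eqF.
apply: le_trans (ler_wpM2l _ V_ge); last lra.
rewrite mul1r -(opprB _ 3) expRN ler_pdivlMr// mulrAC.
rewrite ler_pdivrMr ?expR_gt0//.
have := @cube_le_expR (9 / 2 * z - 3); have := sqr_ge0 (z - 5 / 2); nra.
Qed.

End ExcessArithmetic.

Section Excess.
Variables (R : realType) (d K : nat) (Phi Psi : 'M[R]_(d, K)).
Implicit Types (i j : 'I_K) (x : 'I_K -> R) (y r : 'I_d -> R).

Definition excess i j y : R :=
  Num.max 0 (ip (Psi^~ j) y ^+ 2 - ip (Psi^~ i) y ^+ 2).

Lemma excess_ge0 i j y : 0 <= excess i j y.
Proof. by rewrite le_max lexx. Qed.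

Lemma sup_sq_le_excess i y :
  sup_sq Psi y <= ip (Psi^~ i) y ^+ 2 + \sum_(j | j != i) excess i j y.
Proof.
have sum_ge0 (Q : pred 'I_K) : 0 <= \sum_(j | Q j) excess i j y.
  by apply: sumr_ge0 => j _; exact: excess_ge0.
apply: bigmax_le => [|j _]; first by rewrite addr_ge0 ?sqr_ge0.
have [->|ji] := eqVneq j i; first by rewrite lerDl.
by rewrite -lerBlDl (bigD1 j)//= ler_wpDr ?le_max ?lexx ?orbT.
Qed.

Definition excess_bound (L : R) i : R :=
  \sum_(j | j != i) 4 / 5 * expR (- L) *
    (l2norm (atom_diff Psi Phi i) ^+ 2 + l2norm (atom_diff Psi Phi j) ^+ 2).

Lemma excess_bound_ge0 L i : 0 <= excess_bound L i.
Proof.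
by apply: sumr_ge0 => j _; rewrite !mulr_ge0 ?expR_ge0 ?addr_ge0 ?sqr_ge0.
Qed.

(* The contribution to <psi_j - phi_j, y> of the non-dominant coefficients, which
   fluctuates with their signs. *)
Definition fluctuation i j x : R :=
  \sum_(l | l != i) x l * ip (Phi^~ l) (atom_diff Psi Phi j).

Definition fluctuation_coef i j x l : R :=
  (l != i)%:R * (x l * ip (Phi^~ l) (atom_diff Psi Phi j)).

Lemma fluctuation_signed s i j x :
  fluctuation i j (signed s x) = rademacher (fluctuation_coef i j x) s.
Proof.
rewrite /fluctuation big_mkcond; apply: eq_bigr => l _.
by rewrite /fluctuation_coef mulrCA -mulrA; case: eqP; rewrite (mul0r, mul1r).
Qed.

Lemma sum_sqr_fluctuation_coef_le (A c2 : R) i j x :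
  unit_norm_tight_frame Phi A -> (forall l, l != i -> `|x l| <= c2) ->
  \sum_l fluctuation_coef i j x l ^+ 2 <=
  c2 ^+ 2 * (A * l2norm (atom_diff Psi Phi j) ^+ 2).
Proof.
move=> frame le_c2; rewrite -(tight_frame_sum _ frame) mulr_sumr.
apply: ler_sum => l _; rewrite !exprMn mulrA ler_wpM2r ?sqr_ge0//.
have [_|li] := eqVneq l i; first by rewrite expr0n mul0r sqr_ge0.
by rewrite expr1n mul1r ler_sqr_norm// (le_trans (le_c2 l li)) ?ler_norm.
Qed.

Section Perturbation.
Variables beta eps rho : R.
Hypotheses (dictPhi : is_dict Phi) (beta_lt : beta < 1 / 2) (rho_ge0 : 0 <= rho).
Hypotheses (eps_lt : eps < 1 / 5)
  (diff_le : forall j, l2norm (atom_diff Psi Phi j) <= eps).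
Variables (i : 'I_K) (c2 : R) (x : 'I_K -> R) (r : 'I_d -> R).
Hypotheses (sep : separated_at Phi rho beta i c2 x) (r_le : l2norm r <= rho).

Local Notation y := (synth Phi x r).
Local Notation c := (`|x i|).

Lemma ip_dominant_atom_ge : c + c2 - beta * (c - c2) <= `|ip (Phi^~ i) y|.
Proof.
have [_ _ _ sep_le] := sep; have := analysis_coef_dist x r i dictPhi.
by rewrite distrC => /(le_trans (lerB_dist _ _)); have := r_le; lra.
Qed.

Lemma ip_other_atom_le j : j != i -> `|ip (Phi^~ j) y| <= beta * (c - c2).
Proof.
move=> ji; have [_ _ /(_ j ji) xj sep_le] := sep.
have := le_trans (lerB_dist _ _) (analysis_coef_dist x r j dictPhi).
by have := r_le; lra.
Qed.

Lemma ip_atom_diff_le j :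
  `|ip (atom_diff Psi Phi j) y| <= eps * (c + rho) + `|fluctuation i j x|.
Proof.
rewrite ip_synth (bigD1 i)//= -/(fluctuation i j x) addrAC mulrDr.
apply: le_trans (ler_normD _ _) _; rewrite lerD2r.
apply: le_trans (ler_normD _ _) _; apply: lerD.
  rewrite normrM mulrC ler_wpM2r//; apply: le_trans (ip_le_l2norm _ _) _.
  by rewrite dictPhi mul1r.
by apply: le_trans (ip_le_l2norm _ _) _; rewrite ler_pM ?l2norm_ge0.
Qed.

Lemma ip_perturbedE j :
  ip (Psi^~ j) y = ip (Phi^~ j) y + ip (atom_diff Psi Phi j) y.
Proof. by rewrite ipBl addrC subrK. Qed.

Lemma ip_perturbed_other_le j : j != i ->
  `|ip (Psi^~ j) y| <=
  beta * (c - c2) + (eps * (c + rho) + `|fluctuation i j x|).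
Proof.
move=> ji; rewrite ip_perturbedE; apply: le_trans (ler_normD _ _) _.
by rewrite lerD ?ip_other_atom_le ?ip_atom_diff_le.
Qed.

Lemma ip_perturbed_dominant_ge :
  c + c2 - beta * (c - c2) - (eps * (c + rho) + `|fluctuation i i x|) <=
  `|ip (Psi^~ i) y|.
Proof.
rewrite ip_perturbedE; apply: le_trans (lerB_normD _ _).
by rewrite lerB ?ip_dominant_atom_ge ?ip_atom_diff_le.
Qed.

Let c_gt0 : 0 < c. Proof. by have [c20 c2_lt _ _] := sep; exact: le_lt_trans c2_lt. Qed.

Let eps_ge0 : 0 <= eps. Proof. exact: le_trans (l2norm_ge0 _) (diff_le i). Qed.

Lemma excess_eq0 j : j != i ->
  `|fluctuation i i x| + `|fluctuation i j x| <= margin beta eps (c2 / c) * c ->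
  excess i j y = 0.
Proof.
move=> ji fluct_le; apply/max_idPl; rewrite subr_le0 ler_sqr_norm//.
apply: le_trans (ip_perturbed_other_le ji) _.
apply: le_trans ip_perturbed_dominant_ge.
have marginE : margin beta eps (c2 / c) * c =
    (1 - 2 * beta) * c + (1 + 2 * beta) * c2 - 2 * eps * (1 + beta) * c.
  by rewrite /margin; field; rewrite gt_eqF.
have : eps * (c2 + rho) <= eps * (beta * c).
  by rewrite ler_wpM2l//; exact: separated_c2_rho_le sep.
have : 0 <= eps * c2 by rewrite mulr_ge0//; case: sep.
by move: fluct_le; rewrite marginE; lra.
Qed.

Lemma ip_perturbed_other_le_max j : j != i ->
  `|ip (Psi^~ j) y| <= c + `|fluctuation i j x|.
Proof.
move=> ji; apply: le_trans (ip_perturbed_other_le ji) _.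
rewrite addrA lerD2r; have c20 : 0 <= c2 by case: sep.
have beta_ge0 := separated_beta_ge0 rho_ge0 sep.
have rho_le : rho <= 1 / 2 * c.
  have : beta * c <= 1 / 2 * c by rewrite ler_wpM2r// ltW.
  by have := separated_c2_rho_le rho_ge0 sep; lra.
have : eps * (c + rho) <= 1 / 5 * (c + rho).
  by rewrite ler_wpM2r ?addr_ge0 ?(ltW c_gt0)// ltW.
have : beta * (c - c2) <= 1 / 2 * c.
  apply: (@le_trans _ _ (beta * c)); first by rewrite ler_wpM2l// gerBl.
  by rewrite ler_wpM2r// ltW.
by have := c_gt0; lra.
Qed.

(* Below the margin the excess vanishes; above it, [(1 + m)^2 <= e^(2 m)] and
   [2 m <= 2 + lam (m - margin)]. *)
Lemma excess_le_expR j (lam : R) :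
  j != i -> margin beta eps (c2 / c) <= 1 -> 2 <= lam ->
  excess i j y <= c ^+ 2 * (expR 2 *
    expR (lam * ((`|fluctuation i i x| + `|fluctuation i j x|) / c
                 - margin beta eps (c2 / c)))).
Proof.
move=> ji margin_le1 lam2; set m := (_ + _) / c.
have bound_ge0 : 0 <= c ^+ 2 * (expR 2 * expR (lam * (m - margin beta eps (c2 / c)))).
  by rewrite mulr_ge0 ?sqr_ge0// mulr_ge0 ?expR_ge0.
have [m_le|/ltW margin_le] := lerP m (margin beta eps (c2 / c)).
  by rewrite excess_eq0// -ler_pdivrMr.
rewrite ge_max bound_ge0/= lerBlDr; apply: ler_wpDr (sqr_ge0 _) _.
have abs_le : `|ip (Psi^~ j) y| <= c * expR m.
  apply: le_trans (ip_perturbed_other_le_max ji) _.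
  apply: (@le_trans _ _ (c * (1 + m))); last by rewrite ler_pM2l// expR_ge1Dx.
  by rewrite mulrDr mulr1 lerD2l mulrC divfK ?gt_eqF// lerDr.
apply: (@le_trans _ _ ((c * expR m) ^+ 2)).
  by rewrite -(real_normK (num_real (ip _ _))) ler_sqr ?nnegrE ?mulr_ge0 ?expR_ge0.
rewrite exprMn ler_wpM2l ?sqr_ge0// expr2 -!expRD ler_expR.
have : 0 <= (lam - 2) * (m - margin beta eps (c2 / c)) by rewrite mulr_ge0// subr_ge0.
lra.
Qed.

End Perturbation.
End Excess.

(** * Averages over signs and permutations *)

Section SignMean.
Variables (R : realType) (d K : nat) (Phi Psi : 'M[R]_(d, K)) (A : R).
Hypothesis frame : unit_norm_tight_frame Phi A.
Implicit Types (i j : 'I_K) (x : 'I_K -> R) (r : 'I_d -> R).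

Local Notation diff_sqr j := (l2norm (atom_diff Psi Phi j) ^+ 2).

Lemma mean_signed_sqr_ip x r i :
  mean (fun s => ip (Psi^~ i) (synth Phi (signed s x) r) ^+ 2) =
  \sum_l x l ^+ 2 * ip (Phi^~ l) (Psi^~ i) ^+ 2 + ip (Psi^~ i) r ^+ 2.
Proof.
rewrite (eq_mean (g := fun s => (rademacher (fun l => x l * ip (Phi^~ l) (Psi^~ i)) s
    + ip (Psi^~ i) r) ^+ 2)) => [|s].
  by rewrite mean_sqr_rademacher; under eq_bigr do rewrite exprMn.
by rewrite ip_synth; under eq_bigr do rewrite -mulrA.
Qed.

Variables beta eps rho L : R.
Hypotheses (beta_lt : beta < 1 / 2) (rho_ge0 : 0 <= rho) (eps_lt : eps < 1 / 5)
  (diff_le : forall j, l2norm (atom_diff Psi Phi j) <= eps)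
  (eps_le : 2 * A * L * eps <= (1 - 2 * beta) ^+ 2).
Variables (i : 'I_K) (c2 : R) (x : 'I_K -> R) (r : 'I_d -> R).
Hypotheses (sep : separated_at Phi rho beta i c2 x) (r_le : l2norm r <= rho).

Local Notation y s := (synth Phi (signed s x) r).
Local Notation c := (`|x i|).

Let dictPhi : is_dict Phi := frame.1.
Let A_ge1 : 1 <= A := frame_constant_ge1 i frame.
Let eps_ge0 : 0 <= eps := le_trans (l2norm_ge0 _) (diff_le i).

Lemma diff_sqr_le j : diff_sqr j <= eps ^+ 2.
Proof. by rewrite ler_sqr ?nnegrE ?l2norm_ge0. Qed.

Lemma mean_signed_excess_eq0 j : j != i -> 0 < margin beta eps (c2 / c) ->
  diff_sqr i = 0 -> diff_sqr j = 0 ->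
  mean (fun s => excess Psi i j (y s)) = 0.
Proof.
move=> ji margin_gt0 /eqP; rewrite sqrf_eq0 => /eqP diff_i /eqP.
rewrite sqrf_eq0 => /eqP diff_j.
have fluct0 s k : l2norm (atom_diff Psi Phi k) = 0 ->
    fluctuation Phi Psi i k (signed s x) = 0.
  move=> diff_k; apply: big1 => l _.
  have := ip_le_l2norm (Phi^~ l) (atom_diff Psi Phi k).
  by rewrite diff_k mulr0 normr_le0 => /eqP ->; rewrite mulr0.
rewrite (eq_mean (g := fun=> 0)) ?mean_cst ?card_signs_gt0// => s.
apply: (excess_eq0 dictPhi rho_ge0 diff_le (separated_signed s sep) r_le ji).
by rewrite !fluct0// normr0 addr0 normr_signed mulr_ge0 ?(ltW margin_gt0).
Qed.

Lemma mean_signed_excess_chernoff j (lam : R) : j != i ->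
  margin beta eps (c2 / c) <= 1 -> 2 <= lam ->
  mean (fun s => excess Psi i j (y s)) <= c ^+ 2 * (4 * (expR 2 *
    expR ((lam * (c2 / c)) ^+ 2 * (A * (diff_sqr i + diff_sqr j))
          - lam * margin beta eps (c2 / c)))).
Proof.
move=> ji margin_le1 lam2; have [c20 _ le_c2 _] := sep.
set tau := margin _ _ _; set V := _ + diff_sqr j.
pose rad k s := `|rademacher (fluctuation_coef Phi Psi i k x) s|.
have excess_le s : excess Psi i j (y s) <=
    c ^+ 2 * (expR 2 * expR (- (lam * tau))) * expR (lam / c * (rad i s + rad j s)).
  have := excess_le_expR dictPhi beta_lt rho_ge0 eps_lt diff_le
    (separated_signed s sep) r_le (lam := lam) ji.
  rewrite normr_signed !fluctuation_signed -/tau.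
  move=> /(_ margin_le1 lam2) /le_trans; apply.
  rewrite -[leRHS]mulrA ler_wpM2l ?sqr_ge0// -!expRD ler_expR.
  by rewrite -/(rad i s) -/(rad j s); lra.
apply: le_trans (ler_mean excess_le) _; rewrite meanMl -mulrA.
rewrite ler_wpM2l ?sqr_ge0// [leRHS]mulrCA -mulrA ler_wpM2l ?expR_ge0// mulrC.
apply: le_trans (ler_wpM2r (expR_ge0 _) (mean_expR_abs_rademacherM _ _ _)) _.
  by rewrite divr_ge0// (le_trans _ lam2).
rewrite -mulrA ler_pM2l// -expRD ler_expR lerD2r.
have -> : (lam * (c2 / c)) ^+ 2 * (A * V) = (lam / c) ^+ 2 * (c2 ^+ 2 * (A * V)).
  by ring.
rewrite ler_wpM2l ?sqr_ge0// !mulrDr lerD//;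
  exact: sum_sqr_fluctuation_coef_le frame le_c2.
Qed.

Lemma eps_le_gap_sqr : 1 <= L -> 2 * A * eps <= (1 - 2 * beta) ^+ 2.
Proof.
move=> L1; apply: le_trans eps_le; rewrite -[leRHS]mulrA ler_wpM2l ?ler_peMl//.
by rewrite mulr_ge0// (le_trans ler01 A_ge1).
Qed.

Lemma mean_signed_excess_le j : 1 <= L -> j != i ->
  mean (fun s => excess Psi i j (y s)) <=
  x i ^+ 2 * (4 / 5 * expR (- L) * (diff_sqr i + diff_sqr j)).
Proof.
move=> L1 ji; have A_gt0 : 0 < A := lt_le_trans ltr01 A_ge1.
have beta_ge0 := separated_beta_ge0 rho_ge0 sep.
have /andP[q_ge0 q_le] := separated_ratio rho_ge0 sep.
have epsA_le := eps_le_gap_sqr L1.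
have eps2_le : 2 * eps <= (1 - 2 * beta) ^+ 2.
  by apply: le_trans epsA_le; rewrite -mulrA ler_pM2l// ler_peMl ?A_ge1.
have tau_gt0 := margin_gt0 beta_ge0 beta_lt q_ge0 q_le eps_lt eps2_le.
have tau_le1 := margin_le1 beta_ge0 (ltW beta_lt) q_le eps_ge0.
set V := _ + diff_sqr j.
have [V_gt0|V_le0] := ltP 0 V; last first.
  have V_eq0 : V == 0 by rewrite eq_le V_le0 addr_ge0 ?sqr_ge0.
  move: (V_eq0); rewrite paddr_eq0 ?sqr_ge0// => /andP[/eqP diff_i /eqP diff_j].
  by rewrite (eqP V_eq0) !mulr0 mean_signed_excess_eq0.
have V_le : V <= 2 * eps ^+ 2.
  by have := diff_sqr_le i; have := diff_sqr_le j; rewrite /V; lra.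
have eps_gt0 : 0 < eps.
  rewrite lt_def eps_ge0 andbT; apply: contraTneq V_gt0 => eps0.
  by rewrite -leNgt (le_trans V_le)// eps0 expr0n mulr0.
have exponent_ge2 := chernoff_exponent_ge2 A_gt0 eps_ge0 eps_lt epsA_le V_gt0 V_le.
pose lam := 9 * (1 - 2 * beta) ^+ 2 / (2 * (A * V)) / margin beta eps (c2 / c).
have lam_ge2 : 2 <= lam.
  apply: (le_trans exponent_ge2); rewrite ler_pdivlMr// ler_piMr//.
  exact: le_trans exponent_ge2.
apply: le_trans (mean_signed_excess_chernoff ji tau_le1 lam_ge2) _.
rewrite real_normK ?num_real// ler_wpM2l ?sqr_ge0//.
apply: le_trans (chernoff_bound_le L1 A_gt0 eps_le eps_lt eps_gt0 V_gt0 V_le).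
rewrite ler_pM2l// ler_pM2l ?expR_gt0// ler_expR.
apply: chernoff_exponent_le; rewrite ?mulr_gt0 ?margin_ge//.
- by have := beta_lt; lra.
- by rewrite /lam divfK// gt_eqF.
Qed.

Lemma mean_signed_sup_sq_le : ((1 < K)%N -> 1 <= L) ->
  mean (fun s => sup_sq Psi (y s)) <=
  mean (fun s => ip (Psi^~ i) (y s) ^+ 2)
  + x i ^+ 2 * excess_bound Phi Psi L i.
Proof.
move=> L1; apply: le_trans (ler_mean (fun s => sup_sq_le_excess Psi i (y s))) _.
rewrite meanD lerD2l mean_sum mulr_sumr; apply: ler_sum => j ji.
apply: mean_signed_excess_le (ji); apply: L1.
by have := max_card (pred2 j i); rewrite card2 ji card_ord.
Qed.

End SignMean.

Section Symmetrized.
Variables (R : realType) (d K : nat).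
Implicit Types (Phi Psi : 'M[R]_(d, K)) (x : 'I_K -> R) (r : 'I_d -> R)
  (A : R).

Definition symmetrized (f : ('I_K -> R) -> R) x : R :=
  mean (fun p : {perm 'I_K} => mean (fun s => f (signed s (fun l => x (p l))))).

Definition energy x : R := \sum_i x i ^+ 2.

Definition peak_energy x : R := \big[Num.max/0]_i x i ^+ 2.

Lemma peak_energyE x i : (forall j, `|x j| <= `|x i|) -> peak_energy x = x i ^+ 2.
Proof.
move=> max_i; apply/le_anti/andP; split; last first.
  exact: (@le_bigmax _ _ _ _ (fun j => x j ^+ 2)).
by apply: bigmax_le => [|j _]; [exact: sqr_ge0|exact: ler_sqr_norm].
Qed.

Lemma rest_energyE x i : (forall j, `|x j| <= `|x i|) ->
  energy x - peak_energy x = \sum_(l | l != i) x l ^+ 2.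
Proof.
by move=> /peak_energyE ->; rewrite /energy (bigD1 i)//= addrAC subrr add0r.
Qed.

Lemma peak_energy_ge0 x : 0 <= peak_energy x.
Proof. exact: bigmax_ge_id. Qed.

Lemma energy_ge0 x : 0 <= energy x.
Proof. by apply: sumr_ge0 => i _; exact: sqr_ge0. Qed.

Lemma peak_energy_le x : peak_energy x <= energy x.
Proof.
apply: bigmax_le => [|i _]; first exact: energy_ge0.
by rewrite /energy (bigD1 i)//= lerDl sumr_ge0// => j _; exact: sqr_ge0.
Qed.

Definition peak_gain Phi Psi (delta : 'I_K -> R) : R :=
  mean (fun j => ip (Phi^~ j) (Psi^~ j) ^+ 2 + delta j).

Definition rest_gain Phi Psi A : R :=
  mean (fun j => A - ip (Phi^~ j) (Psi^~ j) ^+ 2) / (K%:R - 1).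

(* The average of [<psi_i, y>^2], with [i] the index of the largest coefficient, over
   all sign changes and permutations of the coefficients [x]; [delta] is an error
   proportional to the energy of the largest coefficient. *)
Definition mean_response Phi Psi A (delta : 'I_K -> R) x r : R :=
  peak_energy x * peak_gain Phi Psi delta
  + (energy x - peak_energy x) * rest_gain Phi Psi A
  + mean (fun j => ip (Psi^~ j) r ^+ 2).

Lemma peak_gainE Phi Psi (delta : 'I_K -> R) : peak_gain Phi Psi delta =
  mean (fun j => ip (Phi^~ j) (Psi^~ j) ^+ 2) + mean delta.
Proof. exact: meanD. Qed.

Lemma rest_gainE Phi Psi A : (0 < K)%N -> rest_gain Phi Psi A =
  (A - mean (fun j => ip (Phi^~ j) (Psi^~ j) ^+ 2)) / (K%:R - 1).
Proof. by move=> K0; rewrite /rest_gain meanB mean_cst ?card_ord. Qed.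

Lemma peak_gain_ge0 Phi Psi (delta : 'I_K -> R) :
  (forall j, 0 <= delta j) -> 0 <= peak_gain Phi Psi delta.
Proof. by move=> delta_ge0; apply: mean_ge0 => j; rewrite addr_ge0 ?sqr_ge0. Qed.

Lemma rest_gain_ge0 Phi Psi A : (0 < K)%N -> unit_norm_tight_frame Phi A ->
  is_dict Psi -> 0 <= rest_gain Phi Psi A.
Proof.
move=> K0 frame dictPsi; rewrite divr_ge0 ?subr_ge0 ?ler1n//; apply: mean_ge0 => j.
by rewrite -(tight_frame_sum_off j frame)// sumr_ge0// => l _; exact: sqr_ge0.
Qed.

Lemma mean_response_ge0 Phi Psi A (delta : 'I_K -> R) x r : (0 < K)%N ->
  unit_norm_tight_frame Phi A -> is_dict Psi -> (forall j, 0 <= delta j) ->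
  0 <= mean_response Phi Psi A delta x r.
Proof.
move=> K0 frame dictPsi delta_ge0.
rewrite addr_ge0//; last by apply: mean_ge0 => j; exact: sqr_ge0.
apply: addr_ge0.
  exact: mulr_ge0 (peak_energy_ge0 x) (peak_gain_ge0 _ _ delta_ge0).
by rewrite mulr_ge0 ?subr_ge0 ?peak_energy_le ?rest_gain_ge0.
Qed.

Lemma mean_responseE Phi Psi A delta x r i :
  unit_norm_tight_frame Phi A -> is_dict Psi -> (forall j, `|x j| <= `|x i|) ->
  mean (fun p : {perm 'I_K} =>
    mean (fun s =>
      ip (Psi^~ (p^-1%g i)) (synth Phi (signed s (fun l => x (p l))) r) ^+ 2)
    + x i ^+ 2 * delta (p^-1%g i)) = mean_response Phi Psi A delta x r.
Proof.
move=> frame dictPsi max_i; under eq_mean do rewrite mean_signed_sqr_ip.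
pose gram_sqr j l := ip (Phi^~ l) (Psi^~ j) ^+ 2.
rewrite !meanD meanMl (mean_perm_sum (fun l => x l ^+ 2) gram_sqr).
rewrite (mean_permV1 delta) (mean_permV1 (fun j => ip (Psi^~ j) r ^+ 2)).
rewrite card_ord /mean_response peak_gainE (rest_energyE max_i) (peak_energyE max_i).
rewrite (eq_mean (fun j => tight_frame_sum_off j frame dictPsi)) mulrDr.
by rewrite [LHS]addrAC; congr (_ + _); rewrite addrAC.
Qed.

Definition mean_sup_sq Phi Psi x r : R :=
  symmetrized (fun x => sup_sq Psi (synth Phi x r)) x.

Lemma mean_sup_sq_ge0 Phi Psi x r : 0 <= mean_sup_sq Phi Psi x r.
Proof. by apply: mean_ge0 => p; apply: mean_ge0 => s; exact: bigmax_ge_id. Qed.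

Lemma mean_sup_sq_ge Phi Psi A x r : (0 < K)%N ->
  unit_norm_tight_frame Phi A -> is_dict Psi ->
  mean_response Phi Psi A (fun=> 0) x r <=
  mean_sup_sq Phi Psi x r.
Proof.
move=> K0 frame dictPsi.
have [i _ max_i] := @arg_maxP _ _ _ (Ordinal K0) predT (fun j => `|x j|) isT.
rewrite -(mean_responseE _ _ frame dictPsi (fun j => max_i j isT)).
apply: ler_mean => p; rewrite mulr0 addr0; apply: ler_mean => s.
exact: (@le_bigmax _ _ _ _ (fun j => ip (Psi^~ j) _ ^+ 2)).
Qed.

Lemma mean_sup_sq_le Phi Psi (A beta eps rho L c2 : R) i x r :
  unit_norm_tight_frame Phi A -> is_dict Psi -> beta < 1 / 2 -> eps < 1 / 5 ->
  (forall j, l2norm (atom_diff Psi Phi j) <= eps) ->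
  2 * A * L * eps <= (1 - 2 * beta) ^+ 2 -> ((1 < K)%N -> 1 <= L) ->
  separated_at Phi rho beta i c2 x -> l2norm r <= rho ->
  mean_sup_sq Phi Psi x r <=
  mean_response Phi Psi A (excess_bound Phi Psi L) x r.
Proof.
move=> frame dictPsi beta_lt eps_lt diff_le eps_le L1 sep r_le.
have rho_ge0 : 0 <= rho := le_trans (l2norm_ge0 r) r_le.
rewrite -(mean_responseE _ _ frame dictPsi (separated_max sep)).
apply: ler_mean => p; rewrite -{2}(permKV p i).
exact: (mean_signed_sup_sq_le frame beta_lt rho_ge0 eps_lt diff_le eps_le
  (separated_perm p sep) r_le L1).
Qed.

End Symmetrized.

(** * Laws of random vectors *)

Section Law.
Variables (R : realType) (dT : measure_display) (T : measurableType dT).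
Variables (P : probability T R) (I : finType).

(* Independence and symmetry of laws are only tested on boxes, so a random vector is
   viewed as a map into [I -> R] with the sigma-algebra generated by boxes. *)
Definition boxes : set (set (I -> R)) :=
  [set B | exists2 A : I -> set R, (forall i, measurable (A i)) &
    B = [set v | forall i, A i (v i)]].

Definition vecR := g_sigma_algebraType boxes.
HB.instance Definition _ := Measurable.on vecR.

Lemma measurable_coord i : measurable_fun setT (fun v : vecR => v i : R).
Proof.
move=> _ Y mY; rewrite setTI; apply: sub_sigma_algebra.
exists (fun j => if j == i then Y else setT) => [j|]; first by case: ifP.
apply/seteqP; split => v /= Yv; last by have := Yv i; rewrite eqxx.
by move=> j; case: eqP => // ->.
Qed.

Lemma measurable_vec (F : I -> T -> R) : (forall i, measurable_fun setT (F i)) ->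
  measurable_fun setT (fun w => F^~ w : vecR).
Proof.
move=> mF; apply: (@measurability _ _ T vecR setT _ boxes) => //.
move=> _ [_ [A mA ->] <-]; rewrite setTI.
have -> : (fun w => F^~ w : vecR) @^-1` [set v | forall i, A i (v i)] =
    \bigcap_(i in [set: I]) (F i @^-1` A i).
  by apply/seteqP; split => w /= AF i; [move=> _|]; apply: AF.
apply: fin_bigcap_measurable => // i _.
by rewrite -[X in measurable X]setTI; exact: mF.
Qed.

Lemma setI_closed_boxes : setI_closed boxes.
Proof.
move=> _ _ [A mA ->] [B mB ->]; exists (fun i => A i `&` B i).
  by move=> i; exact: measurableI.
apply/seteqP; split => v /= => [[Av Bv] i|ABv]; first by split.
by split => i; have [] := ABv i.
Qed.

Lemma eq_law_integral (F G : I -> T -> R) (f : vecR -> R) :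
  (forall i, measurable_fun setT (F i)) -> (forall i, measurable_fun setT (G i)) ->
  (forall A : I -> set R, (forall i, measurable (A i)) ->
    P [set w | forall i, A i (F i w)] = P [set w | forall i, A i (G i w)]) ->
  measurable_fun setT f -> (forall v, 0 <= f v) ->
  (\int[P]_w (f (F^~ w))%:E = \int[P]_w (f (G^~ w))%:E)%E.
Proof.
move=> mF mG FG mf f0.
have mfE : measurable_fun setT (EFin \o f) by exact/measurable_EFinP.
pose vec (H : I -> T -> R) (mH : forall i, measurable_fun setT (H i)) :
    {mfun T >-> vecR} :=
  HB.pack (fun w => H^~ w : vecR)
    (isMeasurableFun.Build _ _ _ _ _ (measurable_vec mH)).
have integral_law H mH : (\int[P]_w (f (H^~ w))%:E =
    \int[distribution P (@vec H mH)]_v (f v)%:E)%E.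
  by rewrite ge0_integral_distribution.
rewrite (integral_law F mF) (integral_law G mG).
apply: eq_measure_integral => A mA _.
apply: (@measure_unique _ R vecR boxes (fun=> setT) _ _ _ _
  (distribution P (vec F mF)) (distribution P (vec G mG))) => //.
- exact: setI_closed_boxes.
- by move=> _; exists (fun=> setT) => //; apply/seteqP; split.
- by rewrite bigcup_const//; exists 0%N.
- by move=> _ [B mB ->]; exact: FG.
- by move=> _; rewrite (le_lt_trans (probability_le1 _ _))// ltry.
Qed.

Lemma probability_ae_exists (Q : T -> Prop) : {ae P, forall w, Q w} -> exists w, Q w.
Proof.
have PT_gt0 : (0 < P [set: T])%E by rewrite probability_setT lte01.
have ae_proper := ae_properfilter_algebraOfSetsType PT_gt0.
exact: filter_ex.
Qed.

End Law.

Section MeasurableFinite.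
Variables (R : realType) (dT : measure_display) (T : measurableType dT).

Lemma measurable_bigmax (J : Type) (s : seq J) (F : J -> T -> R) :
  (forall j, measurable_fun setT (F j)) ->
  measurable_fun setT (fun w => \big[Num.max/0]_(j <- s) F j w).
Proof.
move=> mF; elim: s => [|j s IHs].
  by under eq_fun do rewrite big_nil; exact: measurable_cst.
by under eq_fun do rewrite big_cons; exact: measurable_maxr.
Qed.

Lemma measurable_mean (U : finType) (F : U -> T -> R) :
  (forall u, measurable_fun setT (F u)) ->
  measurable_fun setT (fun w => mean (F^~ w)).
Proof. by move=> mF; apply: measurable_funM => //; exact: measurable_sum. Qed.

Lemma integral_mean_cst (mu : {measure set T -> \bar R}) (U : finType)
    (F : U -> T -> R) c :
  (0 < #|U|)%N -> (forall u, measurable_fun setT (F u)) -> (forall u w, 0 <= F u w) ->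
  (forall u, \int[mu]_w (F u w)%:E = c)%E -> (\int[mu]_w (mean (F^~ w))%:E = c)%E.
Proof.
move=> U0 mF F0 Fc.
have n0 : #|U|%:R != 0 :> R by rewrite pnatr_eq0 -lt0n.
under eq_integral do rewrite /mean mulrC EFinM -sumEFin.
rewrite ge0_integralZl_EFin ?invr_ge0//; last 2 first.
- by move=> w _; rewrite sume_ge0// => u _; rewrite lee_fin.
- by apply: emeasurable_sum => u; exact/measurable_EFinP.
rewrite ge0_integral_sum//; last 2 first.
- by move=> u; exact/measurable_EFinP.
- by move=> u w _; rewrite lee_fin.
rewrite (eq_bigr _ (fun u _ => Fc u)) sumr_const.
have -> : (c *+ #|U|)%R = (#|U|%:R%:E * c)%E by rewrite mule_natl.
by rewrite muleA -EFinM mulVf// mul1e.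
Qed.

End MeasurableFinite.

Section Symmetry.
Variables (R : realType) (d K : nat).
Implicit Types f : ('I_K -> R) -> ('I_d -> R) -> R.

Definition measurable_joint f : Prop :=
  measurable_fun [set: vecR R ('I_K + 'I_d)%type]
    (fun v : vecR R ('I_K + 'I_d)%type => f (fun i => v (inl i)) (fun k => v (inr k))).

Lemma measurable_joint_sup_sq (Psi Phi : 'M[R]_(d, K)) :
  measurable_joint (fun x r => sup_sq Psi (synth Phi x r)).
Proof.
apply: measurable_bigmax => i; apply: measurable_funX.
apply: measurable_sum => k; apply: measurable_funM => //.
apply: measurable_funD; last exact: measurable_coord.
by apply: measurable_sum => l; apply: measurable_funM => //; exact: measurable_coord.
Qed.

Variables (dT : measure_display) (T : measurableType dT) (P : probability T R).
Variables (X : 'I_K -> {RV P >-> R}) (Rn : 'I_d -> {RV P >-> R}).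
Hypotheses (indep : indep_vec P (fun i => X i : T -> R) (fun k => Rn k : T -> R))
  (symX : symmetric_law P (fun i => X i : T -> R)).

Definition joint (F : 'I_K -> T -> R) (k : 'I_K + 'I_d) : T -> R :=
  match k with inl i => F i | inr j => Rn j end.

Lemma measurable_fun_joint (F : 'I_K -> T -> R) k :
  (forall i, measurable_fun setT (F i)) -> measurable_fun setT (joint F k).
Proof. by move=> mF; case: k. Qed.

Definition signed_perm (s : {ffun 'I_K -> bool}) (p : {perm 'I_K}) i w : R :=
  (-1) ^+ s i * X (p i) w.

Lemma measurable_signed_perm s p i : measurable_fun setT (signed_perm s p i).
Proof. exact: measurable_funM. Qed.

Lemma measurable_fun_signed_perm f s p : measurable_joint f ->
  measurable_fun setT (fun w => f ((signed_perm s p)^~ w) (fun k => Rn k w)).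
Proof.
move=> mf; have mJ k : measurable_fun setT (joint (signed_perm s p) k).
  exact/measurable_fun_joint/measurable_signed_perm.
exact: (measurableT_comp mf (measurable_vec mJ)).
Qed.

Lemma eq_law_signed_perm s p (A : 'I_K + 'I_d -> set R) :
  (forall k, measurable (A k)) ->
  P [set w | forall k, A k (joint (fun i => X i) k w)] =
  P [set w | forall k, A k (joint (signed_perm s p) k w)].
Proof.
move=> mA.
have split_box F : [set w | forall k, A k (joint F k w)] =
    box_event F (A \o inl) `&` box_event (fun k => Rn k : T -> R) (A \o inr).
  apply/seteqP; split => w /= => [Aw|[Al Ar] [k|k]]; [|exact: Al|exact: Ar].
  by split => k; [exact: (Aw (inl k))|exact: (Aw (inr k))].
pose A' j := (fun t : R => (-1) ^+ s (p^-1%g j) * t) @^-1` A (inl (p^-1%g j)).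
have mA' j : measurable (A' j).
  by rewrite -[X in measurable X]setTI; apply: measurable_funM.
have signed_permE :
    box_event (signed_perm s p) (A \o inl) = box_event (fun i => X i : T -> R) A'.
  apply/seteqP; split => w Aw i; last by have := Aw (p i); rewrite /A' /= permK.
  by have := Aw (p^-1%g i); rewrite /A' /signed_perm /= permKV.
rewrite !split_box signed_permE !indep//; try by move=> k; exact: mA.
by rewrite -signed_permE; congr (_ * _)%E; apply: symX => k; exact: mA.
Qed.

Lemma integral_symmetrized f : measurable_joint f -> (forall x r, 0 <= f x r) ->
  (\int[P]_w (symmetrized (f^~ (fun k => Rn k w)) (fun i => X i w))%:E =
   \int[P]_w (f (fun i => X i w) (fun k => Rn k w))%:E)%E.
Proof.
move=> mf f0; apply: integral_mean_cst => [|p|p w|p].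
- by apply/card_gt0P; exists 1%g.
- by apply: measurable_mean => s; exact: (measurable_fun_signed_perm s p mf).
- exact: mean_ge0.
apply: integral_mean_cst => // [|s|s]; first exact: card_signs_gt0.
  exact: (measurable_fun_signed_perm s p mf).
apply/esym; apply: (@eq_law_integral _ _ _ P _ (joint (fun i => X i))
  (joint (signed_perm s p))
  (fun v => f (fun i => v (inl i)) (fun k => v (inr k)))) => //.
- by move=> k; exact: measurable_fun_joint.
- by move=> k; exact/measurable_fun_joint/measurable_signed_perm.
- exact: eq_law_signed_perm.
Qed.

Lemma measurable_fun_symmetrized f : measurable_joint f ->
  measurable_fun setT
    (fun w => symmetrized (f^~ (fun k => Rn k w)) (fun i => X i w)).
Proof.
move=> mf; apply: measurable_mean => p; apply: measurable_mean => s.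
exact: (measurable_fun_signed_perm s p mf).
Qed.

End Symmetry.

(** * The mean response *)

Lemma integrableM_sqr (R : realType) (dT : measure_display) (T : measurableType dT)
    (mu : {measure set T -> \bar R}) (f g : T -> R) :
  measurable_fun setT f -> measurable_fun setT g ->
  mu.-integrable setT (fun w => (f w ^+ 2)%:E) ->
  mu.-integrable setT (fun w => (g w ^+ 2)%:E) ->
  mu.-integrable setT (fun w => (f w * g w)%:E).
Proof.
move=> mf mg f2 g2; have := integrableD measurableT f2 g2.
apply: le_integrable => //; first by apply/measurable_EFinP; exact: measurable_funM.
move=> w _; rewrite -EFinD !abse_EFin lee_fin.
rewrite [leRHS]ger0_norm; last by rewrite addr_ge0 ?sqr_ge0.
have := sqr_ge0 (f w - g w); have := sqr_ge0 (f w + g w).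
by rewrite sqrrB sqrrD; have := sqr_ge0 (f w); have := sqr_ge0 (g w);
  case: (ger0P (f w * g w)); lra.
Qed.

Section Noise.
Variables (R : realType) (d : nat) (dT : measure_display) (T : measurableType dT).
Variables (P : probability T R) (Rn : 'I_d -> {RV P >-> R}) (rho : R).
Hypothesis cov : forall k l,
  ('E_P[Rn k \* Rn l] = (if k == l then rho ^+ 2 else 0)%:E)%E.

Lemma integral_noiseM k l :
  (\int[P]_w (Rn k w * Rn l w)%:E = (if k == l then rho ^+ 2 else 0)%:E)%E.
Proof. by rewrite -cov unlock. Qed.

Lemma integrable_noiseM k l : P.-integrable setT (fun w => (Rn k w * Rn l w)%:E).
Proof.
suff sqr_int m : P.-integrable setT (fun w => (Rn m w ^+ 2)%:E).
  exact: integrableM_sqr.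
apply/integrableP; split; first by apply/measurable_EFinP; exact: measurable_funX.
under eq_integral do rewrite gee0_abs ?lee_fin ?sqr_ge0// expr2.
by rewrite integral_noiseM ltry.
Qed.

Lemma integral_sqr_ip_noise u :
  (\int[P]_w (ip u (fun k => Rn k w) ^+ 2)%:E = (rho ^+ 2 * ip u u)%:E)%E.
Proof.
have ip_sqrE w : (ip u (fun k => Rn k w) ^+ 2)%:E =
    (\sum_k \sum_l (u k * u l)%:E * (Rn k w * Rn l w)%:E)%E.
  rewrite expr2 mulr_suml -sumEFin; apply: eq_bigr => k _.
  by rewrite mulr_sumr -sumEFin; apply: eq_bigr => l _; rewrite -EFinM mulrACA.
have int_kl k l : P.-integrable setT (fun w => (u k * u l)%:E * (Rn k w * Rn l w)%:E)%E.
  by apply: integrableZl => //; exact: integrable_noiseM.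
under eq_integral do rewrite ip_sqrE.
rewrite integral_sum//; last by move=> k; exact: integrable_sum.
rewrite mulr_sumr -sumEFin; apply: eq_bigr => k _; rewrite integral_sum//.
rewrite (bigD1 k)//= integralZl//; last exact: integrable_noiseM.
rewrite integral_noiseM eqxx big1 ?adde0 -?EFinM 1?mulrC// => l lk.
rewrite integralZl//; last exact: integrable_noiseM.
by rewrite integral_noiseM eq_sym (negbTE lk) mule0.
Qed.

End Noise.

Section Energy.
Variables (R : realType) (K : nat) (dT : measure_display) (T : measurableType dT).
Variables (P : probability T R) (X : 'I_K -> {RV P >-> R}) (c1bar : R).
Hypothesis sphere : {ae P, forall w, l2norm (fun i => X i w) = 1}.
Hypothesis peak :
  (\int[P]_w (\big[Num.max/0]_(i < K) (X i w) ^+ 2)%:E)%E = (c1bar ^+ 2)%:E.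

Local Notation x w := (fun i => X i w).

Lemma sphere_dim_gt0 : (0 < K)%N.
Proof.
have [w] := probability_ae_exists sphere; case: K X => // X0 /eqP.
by rewrite /l2norm big_ord0 sqrtr0 eq_sym oner_eq0.
Qed.

Lemma measurable_peak_energy : measurable_fun setT (fun w => peak_energy (x w)).
Proof. by apply: measurable_bigmax => i; exact: measurable_funX. Qed.

Lemma measurable_energy : measurable_fun setT (fun w => energy (x w)).
Proof. by apply: measurable_sum => i; exact: measurable_funX. Qed.

Lemma measurable_rest_energy :
  measurable_fun setT (fun w => energy (x w) - peak_energy (x w)).
Proof. exact: measurable_funB measurable_energy measurable_peak_energy. Qed.

Lemma integral_energy : (\int[P]_w (energy (x w))%:E = 1)%E.
Proof.
transitivity (\int[P]_w (cst 1 w))%E; last first.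
  by rewrite integral_cst//= mul1e probability_setT.
apply: ae_eq_integral => //; first by apply/measurable_EFinP; exact: measurable_energy.
apply: filterS sphere => w xw _; congr EFin.
have := l2norm_sqr (x w); rewrite xw expr1n => ->.
by apply: eq_bigr => i _; rewrite expr2.
Qed.

Lemma integral_rest_energy :
  (\int[P]_w (energy (x w) - peak_energy (x w))%:E = (1 - c1bar ^+ 2)%:E)%E.
Proof.
rewrite EFinB -integral_energy -peak.
under [X in (_ = X - _)%E]eq_integral => w _ do
  rewrite -(subrK (peak_energy (x w)) (energy (x w))) EFinD.
rewrite ge0_integralD//.
- by rewrite addeK// peak.
- by move=> w _; rewrite lee_fin subr_ge0 peak_energy_le.
- by apply/measurable_EFinP; exact: measurable_rest_energy.
- by move=> w _; rewrite lee_fin peak_energy_ge0.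
- by apply/measurable_EFinP; exact: measurable_peak_energy.
Qed.

Lemma c1bar_sqr_le1 : c1bar ^+ 2 <= 1.
Proof.
rewrite -subr_ge0 -lee_fin -integral_rest_energy.
by apply: integral_ge0 => w _; rewrite lee_fin subr_ge0 peak_energy_le.
Qed.

(* Every other coefficient is at most half as large as the dominant one. *)
Lemma separated_rest_energy_le d (Phi : 'M[R]_(d, K)) (rho beta c2 : R) i
    (z : 'I_K -> R) :
  beta < 1 / 2 -> 0 <= rho -> separated_at Phi rho beta i c2 z ->
  energy z - peak_energy z <= (K%:R - 1) / 4 * peak_energy z.
Proof.
move=> beta_lt rho_ge0 sep; have [c20 c2_lt le_c2 _] := sep.
rewrite (rest_energyE (separated_max sep)) (peak_energyE (separated_max sep)).
have -> : (K%:R - 1) / 4 * z i ^+ 2 = \sum_(l < K | l != i) z i ^+ 2 / 4.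
  by rewrite sumr_const -[RHS]mulr_natl natr_cardC1 card_ord mulrA mulrAC.
apply: ler_sum => l li.
have : beta * `|z i| <= 1 / 2 * `|z i| by rewrite ler_wpM2r// ltW.
have := separated_c2_rho_le rho_ge0 sep; have := le_c2 l li; have := normr_ge0 (z l).
rewrite -(real_normK (num_real (z l))) -(real_normK (num_real (z i))).
by move: `|z l| `|z i| => a b; nra.
Qed.

Lemma c1bar_sqr_ge d (Phi : 'M[R]_(d, K)) (rho beta : R) : beta < 1 / 2 -> 0 <= rho ->
  {ae P, forall w, exists i (c2 : R), separated_at Phi rho beta i c2 (x w)} ->
  1 - c1bar ^+ 2 <= (K%:R - 1) / 4 * c1bar ^+ 2.
Proof.
move=> beta_lt rho_ge0 sep.
have k_ge0 : 0 <= (K%:R - 1) / 4 :> R.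
  by rewrite divr_ge0// subr_ge0 ler1n sphere_dim_gt0.
rewrite -lee_fin -integral_rest_energy EFinM -peak -ge0_integralZl_EFin//.
- apply: ae_ge0_le_integral => //.
  + by move=> w _; rewrite lee_fin subr_ge0 peak_energy_le.
  + by apply/measurable_EFinP; exact: measurable_rest_energy.
  + by move=> w _; rewrite mule_ge0 ?lee_fin ?peak_energy_ge0.
  + by apply: measurable_funeM; apply/measurable_EFinP; exact: measurable_peak_energy.
  apply: filterS sep => w [i [c2 sep_w]] _; rewrite -EFinM lee_fin.
  exact: separated_rest_energy_le sep_w.
- by move=> w _; rewrite lee_fin peak_energy_ge0.
- by apply/measurable_EFinP; exact: measurable_peak_energy.
Qed.

End Energy.

Section MeanResponse.
Variables (R : realType) (d K : nat) (Phi Psi : 'M[R]_(d, K)) (A : R).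
Hypotheses (frame : unit_norm_tight_frame Phi A) (dictPsi : is_dict Psi).
Variable delta : 'I_K -> R.
Hypothesis delta_ge0 : forall j, 0 <= delta j.
Variables (dT : measure_display) (T : measurableType dT) (P : probability T R).
Variables (X : 'I_K -> {RV P >-> R}) (Rn : 'I_d -> {RV P >-> R}) (rho c1bar : R).
Hypothesis cov : forall k l,
  ('E_P[Rn k \* Rn l] = (if k == l then rho ^+ 2 else 0)%:E)%E.
Hypothesis sphere : {ae P, forall w, l2norm (fun i => X i w) = 1}.
Hypothesis peak :
  (\int[P]_w (\big[Num.max/0]_(i < K) (X i w) ^+ 2)%:E)%E = (c1bar ^+ 2)%:E.

Local Notation x w := (fun i => X i w).
Local Notation r w := (fun k => Rn k w).

Let K0 : (0 < K)%N := sphere_dim_gt0 sphere.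

Lemma measurable_sqr_ip_noise u : measurable_fun setT (fun w => ip u (r w) ^+ 2).
Proof.
by apply: measurable_funX; apply: measurable_sum => k; exact: measurable_funM.
Qed.

Lemma measurable_peak_response :
  measurable_fun setT (fun w => peak_energy (x w) * peak_gain Phi Psi delta).
Proof. by apply: measurable_funM => //; exact: measurable_peak_energy. Qed.

Lemma measurable_rest_response : measurable_fun setT
  (fun w => (energy (x w) - peak_energy (x w)) * rest_gain Phi Psi A).
Proof. by apply: measurable_funM => //; exact: measurable_rest_energy. Qed.

Lemma measurable_noise_response :
  measurable_fun setT (fun w => mean (fun j => ip (Psi^~ j) (r w) ^+ 2)).
Proof. by apply: measurable_mean => j; exact: measurable_sqr_ip_noise. Qed.

Lemma measurable_mean_response :
  measurable_fun setT (fun w => mean_response Phi Psi A delta (x w) (r w)).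
Proof.
by apply: measurable_funD measurable_noise_response;
  apply: measurable_funD measurable_peak_response measurable_rest_response.
Qed.

Lemma integral_peak_response :
  (\int[P]_w (peak_energy (x w) * peak_gain Phi Psi delta)%:E =
   (c1bar ^+ 2 * peak_gain Phi Psi delta)%:E)%E.
Proof.
under eq_integral do rewrite EFinM.
rewrite ge0_integralZr ?lee_fin ?peak_gain_ge0// ?peak -?EFinM//.
- by apply/measurable_EFinP; exact: measurable_peak_energy.
- by move=> w _; rewrite lee_fin peak_energy_ge0.
Qed.

Lemma integral_rest_response :
  (\int[P]_w ((energy (x w) - peak_energy (x w)) * rest_gain Phi Psi A)%:E =
   ((1 - c1bar ^+ 2) * rest_gain Phi Psi A)%:E)%E.
Proof.
under eq_integral do rewrite EFinM.
rewrite ge0_integralZr ?lee_fin ?rest_gain_ge0//.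
- by rewrite (integral_rest_energy sphere peak) -EFinM.
- by apply/measurable_EFinP; exact: measurable_rest_energy.
- by move=> w _; rewrite lee_fin subr_ge0 peak_energy_le.
Qed.

Lemma integral_noise_response :
  (\int[P]_w (mean (fun j => ip (Psi^~ j) (r w) ^+ 2))%:E = (rho ^+ 2)%:E)%E.
Proof.
apply: integral_mean_cst => [|j|j w|j].
- by rewrite card_ord.
- exact: measurable_sqr_ip_noise.
- exact: sqr_ge0.
- by rewrite (integral_sqr_ip_noise cov) dict_ip1// mulr1.
Qed.

Lemma integral_mean_response :
  (\int[P]_w (mean_response Phi Psi A delta (x w) (r w))%:E =
   (c1bar ^+ 2 * peak_gain Phi Psi delta
    + (1 - c1bar ^+ 2) * rest_gain Phi Psi A + rho ^+ 2)%:E)%E.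
Proof.
have peak_ge0 w : 0 <= peak_energy (x w) * peak_gain Phi Psi delta.
  by rewrite mulr_ge0 ?peak_energy_ge0 ?peak_gain_ge0.
have rest_ge0 w : 0 <= (energy (x w) - peak_energy (x w)) * rest_gain Phi Psi A.
  by rewrite mulr_ge0 ?subr_ge0 ?peak_energy_le ?rest_gain_ge0.
under eq_integral do rewrite 2!EFinD.
rewrite ge0_integralD//; last 4 first.
- by move=> w _; rewrite -EFinD lee_fin addr_ge0.
- apply/measurable_EFinP.
  exact: measurable_funD measurable_peak_response measurable_rest_response.
- by move=> w _; rewrite lee_fin mean_ge0// => j; exact: sqr_ge0.
- by apply/measurable_EFinP; exact: measurable_noise_response.
rewrite ge0_integralD//.
- by rewrite integral_peak_response integral_rest_response integral_noise_response.
- by move=> w _; rewrite lee_fin.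
- by apply/measurable_EFinP; exact: measurable_peak_response.
- by move=> w _; rewrite lee_fin.
- by apply/measurable_EFinP; exact: measurable_rest_response.
Qed.

End MeanResponse.

(** * Local maximality *)

Section GapArithmetic.
Variable R : realType.

Lemma expR1_le4 : expR 1 <= 4 :> R.
Proof.
have half : expR (1 / 2 : R) <= 2.
  rewrite -[X in expR X]opprK expRN -[leRHS]invrK lef_pV2 ?posrE ?expR_gt0//.
  by apply: le_trans (expR_ge1Dx _); lra.
have -> : expR (1 : R) = expR (1 / 2) * expR (1 / 2) by rewrite -expRD; congr expR; lra.
have -> : 4 = 2 * 2 :> R by lra.
by rewrite ler_pM ?expR_ge0.
Qed.

(* The difference between the mean energies of the largest coefficient and of the
   others. *)
Definition energy_gap (K : nat) (c1bar : R) : R :=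
  c1bar ^+ 2 - (1 - c1bar ^+ 2) / (K%:R - 1).

Definition local_max_radius (K : nat) (A c1bar beta : R) : R :=
  (1 - 2 * beta) ^+ 2 / (2 * A * ln (2 * A * K%:R / energy_gap K c1bar)).

Lemma energy_gap_le1 (K : nat) (c1bar : R) : (0 < K)%N -> c1bar ^+ 2 <= 1 ->
  energy_gap K c1bar <= 1.
Proof.
move=> K0 c_le1; rewrite lerBlDr (le_trans c_le1)// lerDl divr_ge0 ?subr_ge0//.
by rewrite ler1n.
Qed.

Lemma energy_gap_gt0 (K : nat) (c1bar : R) : (0 < K)%N ->
  1 - c1bar ^+ 2 <= (K%:R - 1) / 4 * c1bar ^+ 2 -> 0 < energy_gap K c1bar.
Proof.
move=> K0 rest_le; have c_ge0 := sqr_ge0 c1bar.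
have c_gt0 : 0 < c1bar ^+ 2.
  by rewrite lt_def c_ge0 andbT; apply: contraTneq rest_le => ->; lra.
suff : (1 - c1bar ^+ 2) / (K%:R - 1) <= c1bar ^+ 2 / 4 by rewrite /energy_gap; lra.
have [K1|K1] := ltnP 1 K; first by rewrite ler_pdivrMr ?subr_gt0 ?ltr1n//; lra.
have -> : K = 1%N by apply/eqP; rewrite eqn_leq K1.
by rewrite subrr invr0 mulr0 divr_ge0.
Qed.

Lemma ln_ratio_gt0 (A gamma : R) (K : nat) :
  (0 < K)%N -> 1 <= A -> 0 < gamma -> gamma <= 1 -> 0 < ln (2 * A * K%:R / gamma).
Proof.
move=> K0 A1 gamma_gt0 gamma_le1; apply: ln_gt0; rewrite ltr_pdivlMr// mul1r.
have K1 : 1 <= K%:R :> R by rewrite ler1n.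
by have := ler_pM ler01 ler01 A1 K1; lra.
Qed.

Lemma ln_ratio_ge1 (A gamma : R) (K : nat) :
  (1 < K)%N -> 1 <= A -> 0 < gamma -> gamma <= 1 -> 1 <= ln (2 * A * K%:R / gamma).
Proof.
move=> K1 A1 gamma_gt0 gamma_le1.
have ratio_ge4 : 4 <= 2 * A * K%:R / gamma.
  rewrite ler_pdivlMr//; have K2 : 2 <= K%:R :> R by rewrite ler_nat.
  by have := ler_pM ler01 (ler0n _ 2) A1 K2; lra.
by rewrite -ler_expR lnK ?(le_trans expR1_le4)// posrE (lt_le_trans _ ratio_ge4).
Qed.

Lemma mean_excess_lt_mean_loss (K : nat) (e : 'I_K -> R) (A gamma C eps : R) :
  (0 < K)%N -> 1 <= A -> 0 < gamma -> 0 <= C -> C <= 1 ->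
  (forall i, 0 <= e i) -> (forall i, e i <= eps) -> eps < 1 / 5 ->
  (exists i, 0 < e i) ->
  C * mean (fun j => \sum_(l | l != j)
    4 / 5 * (gamma / (2 * A * K%:R)) * (e j ^+ 2 + e l ^+ 2)) <
  gamma * mean (fun j => 1 - (1 - e j ^+ 2 / 2) ^+ 2).
Proof.
move=> K0 A1 gamma_gt0 C_ge0 C_le1 e_ge0 e_le eps_lt [i0 e_i0].
have [A_gt0 K_gt0] : 0 < A /\ 0 < K%:R :> R by rewrite ltr0n (lt_le_trans ltr01).
set kappa := 4 / 5 * _; pose S := mean (fun j => e j ^+ 2).
have kappa_ge0 : 0 <= kappa.
  by rewrite mulr_ge0// divr_ge0 ?mulr_ge0 ?(ltW gamma_gt0) ?(ltW A_gt0).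
have S_gt0 : 0 < S.
  rewrite divr_gt0 ?card_ord// (bigD1 i0)//= ltr_pwDl ?exprn_gt0//.
  by rewrite sumr_ge0// => j _; exact: sqr_ge0.
have loss_ge : 99 / 100 * S <= mean (fun j => 1 - (1 - e j ^+ 2 / 2) ^+ 2).
  rewrite -meanMl; apply: ler_mean => j.
  have : e j ^+ 2 <= 1 / 25 by have := e_ge0 j; have := e_le j; nra.
  by have := sqr_ge0 (e j); nra.
have excess_ge0 : 0 <= mean (fun j => \sum_(l | l != j) (e j ^+ 2 + e l ^+ 2)).
  by apply: mean_ge0 => j; rewrite sumr_ge0// => l _; rewrite addr_ge0 ?sqr_ge0.
under eq_mean do rewrite -mulr_sumr.
rewrite meanMl; apply: (@le_lt_trans _ _ (kappa * (2 * K%:R * S))).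
  apply: (@le_trans _ _ (1 * (kappa *
      mean (fun j => \sum_(l | l != j) (e j ^+ 2 + e l ^+ 2))))).
    by rewrite ler_wpM2r// mulr_ge0.
  rewrite mul1r ler_wpM2l// -[in leRHS](card_ord K).
  by apply: mean_pair_sum_le => j; exact: sqr_ge0.
have -> : kappa * (2 * K%:R * S) = 4 / 5 * (gamma * S / A).
  by rewrite /kappa; field; rewrite !gt_eqF.
have : gamma * S / A <= gamma * S by rewrite ler_pdivrMr// ler_peMr// ltW// mulr_gt0.
have : gamma * (99 / 100 * S) <= gamma * mean (fun j => 1 - (1 - e j ^+ 2 / 2) ^+ 2).
  by rewrite ler_pM2l.
by have := mulr_gt0 gamma_gt0 S_gt0; lra.
Qed.

End GapArithmetic.

Section LocalMaximum.
Variables (R : realType) (dT : measure_display) (T : measurableType dT).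
Variables (P : probability T R) (d K : nat) (Phi : 'M[R]_(d, K)) (A : R).
Variables (X : 'I_K -> {RV P >-> R}) (Rn : 'I_d -> {RV P >-> R}).
Variables (rho rho_max c1bar beta : R).
Hypothesis frame : unit_norm_tight_frame Phi A.
Hypothesis indep : indep_vec P (fun i => X i : T -> R) (fun k => Rn k : T -> R).
Hypothesis noise_le : {ae P, forall w, l2norm (fun k => Rn k w) <= rho_max}.
Hypothesis cov : forall k l,
  ('E_P[Rn k \* Rn l] = (if k == l then rho ^+ 2 else 0)%:E)%E.
Hypothesis sphere : {ae P, forall w, l2norm (fun i => X i w) = 1}.
Hypothesis symX : symmetric_law P (fun i => X i : T -> R).
Hypothesis peak :
  (\int[P]_w (\big[Num.max/0]_(i < K) (X i w) ^+ 2)%:E)%E = (c1bar ^+ 2)%:E.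
Hypothesis beta_lt : beta < 1 / 2.
Hypothesis sep : {ae P, forall w,
  let x := fun i => X i w in
  0 < c_ x 1 - c_ x 2 /\
  (c_ x 2 + coherence Phi * c_l1 x + rho_max) / (c_ x 1 - c_ x 2) <= beta}.

Local Notation J Psi :=
  (objective P Psi Phi (fun i => X i : T -> R) (fun k => Rn k : T -> R)).
Local Notation gamma := (energy_gap K c1bar).
Local Notation L := (ln (2 * A * K%:R / gamma)).
Local Notation radius := (local_max_radius K A c1bar beta).
Local Notation response_integral Psi delta :=
  (\int[P]_w (mean_response Phi Psi A delta (fun i => X i w) (fun k => Rn k w))%:E)%E.
Implicit Types Psi : 'M[R]_(d, K).

Let dictPhi : is_dict Phi := frame.1.
Let K0 : (0 < K)%N := sphere_dim_gt0 sphere.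
Let A_ge1 : 1 <= A := frame_constant_ge1 (Ordinal K0) frame.

Lemma separated_ae : {ae P, forall w, exists i (c2 : R),
  separated_at Phi rho_max beta i c2 (fun i => X i w)}.
Proof.
apply: filterS sep => w /= [c12 sep_w].
by have [i] := exists_separated_at K0 c12 sep_w; exists i, (c_ (fun i => X i w) 2).
Qed.

Lemma rho_max_ge0 : 0 <= rho_max.
Proof.
by have [w] := probability_ae_exists noise_le; apply: le_trans; exact: l2norm_ge0.
Qed.

Lemma gap_bounds : 0 < gamma <= 1.
Proof.
rewrite energy_gap_le1 ?(c1bar_sqr_le1 sphere peak)// energy_gap_gt0//.
exact: (c1bar_sqr_ge sphere peak (Phi := Phi) beta_lt rho_max_ge0 separated_ae).
Qed.

Lemma radius_gt0 : 0 < radius.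
Proof.
have /andP[gamma_gt0 gamma_le1] := gap_bounds.
rewrite divr_gt0 ?exprn_gt0 ?subr_gt0//; first by have := beta_lt; lra.
by rewrite !mulr_gt0 ?(lt_le_trans ltr01 A_ge1) ?ln_ratio_gt0 ?A_ge1.
Qed.

Lemma expRN_ln_ratio : expR (- L) = gamma / (2 * A * K%:R).
Proof.
have /andP[gamma_gt0 _] := gap_bounds.
rewrite expRN lnK ?invf_div// posrE divr_gt0// !mulr_gt0 ?ltr0n//.
exact: lt_le_trans ltr01 A_ge1.
Qed.

Lemma objectiveE Psi : J Psi =
  (\int[P]_w (mean_sup_sq Phi Psi (fun i => X i w) (fun k => Rn k w))%:E)%E.
Proof.
rewrite (integral_symmetrized indep symX (measurable_joint_sup_sq Psi Phi))//.
by move=> x r; exact: bigmax_ge_id.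
Qed.

Lemma measurable_mean_sup_sq Psi : measurable_fun setT
  (fun w => (mean_sup_sq Phi Psi (fun i => X i w) (fun k => Rn k w))%:E).
Proof.
apply/measurable_EFinP.
exact: measurable_fun_symmetrized (measurable_joint_sup_sq Psi Phi).
Qed.

Lemma objective_ge : (response_integral Phi (fun=> 0%R) <= J Phi)%E.
Proof.
rewrite objectiveE; apply: ge0_le_integral => //.
- by move=> w _; rewrite lee_fin mean_response_ge0.
- by apply/measurable_EFinP; exact: measurable_mean_response.
- exact: measurable_mean_sup_sq.
- by move=> w _; rewrite lee_fin mean_sup_sq_ge.
Qed.

Section Perturbation.
Variables (Psi : 'M[R]_(d, K)) (eps : R).
Hypotheses (dictPsi : is_dict Psi) (eps_lt : eps < 1 / 5) (eps_le : eps <= radius).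
Hypotheses (dist_gt0 : 0 < dict_dist Psi Phi) (dist_le : dict_dist Psi Phi <= eps).

Lemma objective_le : (J Psi <= response_integral Psi (excess_bound Phi Psi L))%E.
Proof.
have /andP[gamma_gt0 gamma_le1] := gap_bounds.
have AL_gt0 : 0 < 2 * A * L.
  by rewrite !mulr_gt0 ?(lt_le_trans ltr01 A_ge1) ?ln_ratio_gt0 ?A_ge1.
rewrite objectiveE; apply: ae_ge0_le_integral => //.
- by move=> w _; rewrite lee_fin mean_sup_sq_ge0.
- exact: measurable_mean_sup_sq.
- by move=> w _; rewrite lee_fin mean_response_ge0//; exact: excess_bound_ge0.
- by apply/measurable_EFinP; exact: measurable_mean_response.
apply: filterS2 noise_le separated_ae => w r_le [i [c2 sep_w]] _; rewrite lee_fin.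
apply: mean_sup_sq_le frame dictPsi beta_lt eps_lt _ _ _ sep_w r_le.
- by move=> j; exact: le_trans (le_dict_dist _ _ _) dist_le.
- by rewrite mulrC -ler_pdivlMr.
- by move=> K1; rewrite ln_ratio_ge1 ?A_ge1.
Qed.

Lemma mean_sqr_ip_atoms :
  mean (fun j => 1 - (1 - l2norm (atom_diff Psi Phi j) ^+ 2 / 2) ^+ 2) =
  1 - mean (fun j => ip (Phi^~ j) (Psi^~ j) ^+ 2).
Proof.
rewrite meanB mean_cst ?card_ord//; congr (1 - _).
by apply: eq_mean => j; rewrite ip_atoms.
Qed.

Lemma mean_excess_bound_lt : c1bar ^+ 2 * mean (excess_bound Phi Psi L) <
  gamma * (1 - mean (fun j => ip (Phi^~ j) (Psi^~ j) ^+ 2)).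
Proof.
have /andP[gamma_gt0 _] := gap_bounds; rewrite /excess_bound expRN_ln_ratio.
rewrite -mean_sqr_ip_atoms; apply: mean_excess_lt_mean_loss eps_lt _ => //.
- exact: sqr_ge0.
- exact: c1bar_sqr_le1 sphere peak.
- by move=> j; exact: l2norm_ge0.
- by move=> j; exact: le_trans (le_dict_dist _ _ _) dist_le.
- exact: dict_dist_gt0.
Qed.

Lemma mean_response_lt : (response_integral Psi (excess_bound Phi Psi L) <
  response_integral Phi (fun=> 0%R))%E.
Proof.
rewrite !(integral_mean_response frame _ _ cov sphere peak)//; last first.
  exact: excess_bound_ge0.
have mean_sqr_ip_self : mean (fun j => ip (Phi^~ j) (Phi^~ j) ^+ 2) = 1.
  by under eq_mean do rewrite dict_ip1// expr1n; rewrite mean_cst ?card_ord.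
rewrite lte_fin !peak_gainE !rest_gainE// mean_sqr_ip_self mean_cst ?card_ord//.
by have := mean_excess_bound_lt; rewrite /energy_gap; lra.
Qed.

Lemma objective_lt : (J Psi < J Phi)%E.
Proof.
exact: le_lt_trans objective_le (lt_le_trans mean_response_lt objective_ge).
Qed.

End Perturbation.
End LocalMaximum.

Theorem theorem4 (R : realType) (dT : measure_display) (T : measurableType dT)
  (P : probability T R) (d K : nat) (Phi : 'M[R]_(d, K))
  (X : 'I_K -> {RV P >-> R}) (Rn : 'I_d -> {RV P >-> R})
  (rho rho_max c1bar beta : R) :
  unit_norm_tight_frame Phi (K%:R / d%:R) ->
  (* noise *)
  indep_vec P (fun i => X i : T -> R) (fun k => Rn k : T -> R) ->
  {ae P, forall w, l2norm (fun k => Rn k w) <= rho_max} ->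
  (forall k, ('E_P[Rn k] = 0)%E) ->
  (forall k l, ('E_P[Rn k \* Rn l] = (if k == l then rho ^+ 2 else 0)%:E)%E) ->
  (* coefficients: symmetric distribution on the sphere S^{K-1} *)
  {ae P, forall w, l2norm (fun i => X i w) = 1} ->
  symmetric_law P (fun i => X i : T -> R) ->
  (\int[P]_w (\big[Num.max/0]_(i < K) (X i w) ^+ 2)%:E)%E = (c1bar ^+ 2)%:E ->
  (* separation assumption *)
  beta < 1 / 2 ->
  {ae P, forall w,
     let x := fun i => X i w in
     0 < c_ x 1 - c_ x 2 /\
     (c_ x 2 + coherence Phi * c_l1 x + rho_max) / (c_ x 1 - c_ x 2) <= beta} ->
  let J := fun Psi : 'M[R]_(d, K) =>
    objective P Psi Phi (fun i => X i : T -> R) (fun k => Rn k : T -> R) in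
  let A := K%:R / d%:R : R in
  (* Phi is a local maximum *)
  (exists eps : R, 0 < eps /\
     forall Psi, is_dict Psi -> dict_dist Psi Phi <= eps -> (J Psi <= J Phi)%E) /\
  (* quantitative strict local maximum *)
  (forall eps : R, eps < 1 / 5 ->
     eps <= (1 - 2 * beta) ^+ 2 /
            (2 * A * ln (2 * A * K%:R /
                (c1bar ^+ 2 - (1 - c1bar ^+ 2) / (K%:R - 1)))) ->
     forall Psi, is_dict Psi -> 0 < dict_dist Psi Phi -> dict_dist Psi Phi <= eps ->
     (J Psi < J Phi)%E).
Proof.
move=> frame indep noise_le _ cov sphere symX peak beta_lt sep J A.
pose radius := local_max_radius K A c1bar beta.
have strict eps Psi : eps < 1 / 5 -> eps <= radius -> is_dict Psi ->
    0 < dict_dist Psi Phi -> dict_dist Psi Phi <= eps -> (J Psi < J Phi)%E.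
  move=> eps_lt eps_le dictPsi dist_gt0 dist_le.
  exact: (objective_lt frame indep noise_le cov sphere symX peak beta_lt sep
    dictPsi eps_lt eps_le dist_gt0 dist_le).
split; last by move=> eps eps_lt eps_le Psi; exact: strict.
have radius_gt0 : 0 < radius := radius_gt0 frame noise_le sphere peak beta_lt sep.
exists (Num.min (1 / 10) radius); split; first by rewrite lt_min radius_gt0 andbT; lra.
move=> Psi dictPsi dist_le.
have [dist_gt0|/dict_dist_le0 ->//] := ltP 0 (dict_dist Psi Phi).
apply/ltW/(strict (Num.min (1 / 10) radius)); rewrite // ?ge_min ?lexx ?orbT//.
by rewrite gt_min; apply/orP; left; lra.
Qed.
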